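(* Let $\rho$ be a quasi-periodic labelling of $\frac{1}{2}\mathbf{Z}$. Then the group $G_{\rho}$ is a finitely generated simple subgroup of $\mathrm{Homeo}^+(\mathbf{R})$.
   Context: $\mathrm{Homeo}^+(\mathbf{R})$ is the group of orientation preserving homeomorphisms of $\mathbf{R}$. All actions are right actions: $x\cdot f$ is the image of $x$ under $f$ and $x\cdot(fg)=(x\cdot f)\cdot g$. $\mathrm{Supp}(f)=\{x\mid x\cdot f\neq x\}$. **The group $H$.** $F$ is Thompson's group: orientation preserving piecewise linear homeomorphisms of $[0,1]$ with finitely many breakpoints (points where the derivative does not exist), all in $\mathbf{Z}[\frac12]$, and whose derivatives, where they exist, are integer powers of $2$. $F_{[r,s]}$ is the subgroup of elements of $F$ with support in $[r,s]$. $F'$ is the derived subgroup. $\iota:[0,1]\to[0,1]$ is the orientation reversing isometry. Fix $c_0\in F$ with $\mathrm{Supp}(c_0)=(0,\frac14)$, $x\cdot c_0>x$ for all $x\in(0,\frac14)$, and $t\cdot c_0=2t$ for $t\in(0,\frac1{16})$. Put $c_1=\iota\circ c_0\circ\iota$, $\nu_1=c_0c_1$, and $H=\langle F',\nu_1\rangle\leq F$. Fix standard generators $\nu_2,\nu_3$ (two elements generating the group $F_{[\frac1{16},\frac{15}{16}]}$). The group $H$ is generated by $\nu_1,\nu_2,\nu_3$. **Labellings.** A labelling is a map $\rho:\frac12\mathbf{Z}\to\{a,b,a^{-1},b^{-1}\}$ with $\rho(k)\in\{a,a^{-1}\}$ for $k\in\mathbf{Z}$ and $\rho(k)\in\{b,b^{-1}\}$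 for $k\in\frac12\mathbf{Z}\setminus\mathbf{Z}$. A block is a set $X=\{k,k+\frac12,\dots,k+\frac12 n\}$ with $k\in\frac12\mathbf{Z}$, $n\in\mathbf{N}$ ($n\ge 0$); $W_\rho(X)$ is the formal word $\rho(k)\rho(k+\frac12)\cdots\rho(k+\frac12n)$, and $W_\rho^{-1}(X)$ is its formal inverse (the formal inverse of $w_1\cdots w_n$ is $w_n^{-1}\cdots w_1^{-1}$). $\rho$ is quasi-periodic if (1) for each block $X$ there is $n\in\mathbf{N}$ such that for every block $Y$ of size at least $n$, $W_\rho(X)$ is a subword (string of consecutive letters) of $W_\rho(Y)$; and (2) for each block $X$ there is a block $Y$ with $W_\rho(Y)=W_\rho^{-1}(X)$. **The group $G_\rho$.** For a homeomorphism $f$ of $[0,1]$ and an interval $J$ of length $1$, write $g\restriction J\cong_T f$ if $g$ preserves $J$ and $g\restriction J$ is the conjugate of $f$ by the orientation preserving isometry $[0,1]\to J$. Define homeomorphisms $\zeta_i,\chi_i$ of $\mathbf{R}$, $i=1,2,3$, by: for all $n\in\mathbf{Z}$, $\zeta_i\restriction[n,n+1]\cong_T\nu_i$ if $\rho(n+\frac12)=b$ and $\cong_T\iota\circ\nu_i\circ\iota$ if $\rho(n+\frac12)=b^{-1}$; $\chi_i\restriction[n-\frac12,n+\frac12]\cong_T\nu_i$ if $\rho(n)=a$ and $\cong_T\iota\circ\nu_i\circ\iota$ if $\rho(n)=a^{-1}$. Then $G_\rho=\langle\zeta_1,\zeta_2,\zeta_3,\chi_1,\chi_2,\chi_3\rangle<\mathrm{Homeo}^+(\mathbf{R})$.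 *)

(* Defs.v *)
From HB Require Import structures.
From mathcomp Require Import all_boot all_order all_algebra.
From mathcomp Require Import all_classical all_reals all_analysis.
From mathcomp Require Import lra.
Set Implicit Arguments.
Unset Strict Implicit.
Unset Printing Implicit Defensive.
Import Order.TTheory GRing.Theory Num.Theory.
Import numFieldNormedType.Exports.

Local Open Scope classical_set_scope.
Local Open Scope ring_scope.

Section AbstractGroups.
Variable gT : groupType.
Implicit Types (S G N : set gT).

Definition subgroup G : Prop := group_closed [in G].

Definition generated S : set gT := smallest subgroup S.

Definition fg_group G : Prop :=
  exists2 S : set gT, finite_set S & G = generated S.

Definition normal_subgroup N G : Prop :=
  [/\ subgroup N, N `<=` G & forall x g, N x -> G g -> N (x ^ g)%g].

Definition simple_group G : Prop :=
  [/\ subgroup G, G <> [set 1%g] &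
      forall N, normal_subgroup N G -> N = [set 1%g] \/ N = G].

End AbstractGroups.

Section HomeoR.
Variable R : realType.

Definition is_homeo_plus (f : R -> R) : Prop :=
  [/\ {homo f : x y / x < y}, continuous f &
      exists g : R -> R, [/\ cancel f g, cancel g f & continuous g]].

Record homeoR := HomeoR {
  homeoR_fun :> R -> R;
  homeoR_subproof : `[< is_homeo_plus homeoR_fun >]
}.

HB.instance Definition _ := [isSub for homeoR_fun].
HB.instance Definition _ := [Choice of homeoR by <:].

Lemma homeoRP (f : homeoR) : is_homeo_plus f.
Proof. exact/asboolP/(valP f). Qed.

Lemma homeoR_eq (f g : homeoR) : f =1 g -> f = g.
Proof. by move=> fg; apply/val_inj/funext. Qed.

Lemma homeoR_homo (f : homeoR) : {homo f : x y / x < y}.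
Proof. by case: (homeoRP f). Qed.

Lemma can_homeo_plus (f g : R -> R) :
  {homo f : x y / x < y} -> cancel f g -> cancel g f -> is_homeo_plus f.
Proof.
have cont (h k : R -> R) : {homo h : x y / x < y} -> cancel h k ->
    cancel k h -> continuous h.
  move=> hi hk kh x; apply/cvgrPdist_lt => e e0.
  have hle : {mono h : x y / x < y} := leW_mono (le_mono hi).
  have xI : x \in `](k (h x - e)), (k (h x + e))[.
    by rewrite in_itv /= -[X in X && _]hle -[X in _ && X]hle !kh; lra.
  near=> y.
  have : y \in `](k (h x - e)), (k (h x + e))[.
    by near: y; exact: near_in_itvoo.
  by rewrite in_itv /= -[X in X && _]hle -[X in _ && X]hle !kh ltr_distlC.
move=> fi fg gf; split => //; first exact: cont fg gf.
exists g; split => //; apply: (cont _ f) => // x y xy.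
by rewrite -(leW_mono (le_mono fi)) !gf.
Unshelve. all: by end_near.
Qed.

Definition mk_homeoR (f g : R -> R) (fi : {homo f : x y / x < y})
    (fg : cancel f g) (gf : cancel g f) : homeoR :=
  HomeoR (asboolT (can_homeo_plus fi fg gf)).

Definition homeoR_inv_fun (f : homeoR) : R -> R :=
  let: And3 _ _ ex := homeoRP f in projT1 (cid ex).

Lemma homeoR_invK (f : homeoR) : cancel f (homeoR_inv_fun f).
Proof.
by rewrite /homeoR_inv_fun; case: (homeoRP f) => _ _ ex; case: cid => ? [].
Qed.

Lemma homeoR_invVK (f : homeoR) : cancel (homeoR_inv_fun f) f.
Proof.
by rewrite /homeoR_inv_fun; case: (homeoRP f) => _ _ ex; case: cid => ? [].
Qed.

Lemma homeoR_mono (f : homeoR) : {mono f : x y / x < y}.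
Proof. exact/leW_mono/le_mono/homeoR_homo. Qed.

Lemma homeoR_inv_homo (f : homeoR) : {homo homeoR_inv_fun f : x y / x < y}.
Proof. by move=> x y xy; rewrite -(homeoR_mono f) !homeoR_invVK. Qed.

Definition homeoR_one : homeoR :=
  mk_homeoR (fun x y (h : x < y) => h) (fun=> erefl) (fun=> erefl).

Definition homeoR_inv (f : homeoR) : homeoR :=
  mk_homeoR (@homeoR_inv_homo f) (@homeoR_invVK f) (@homeoR_invK f).

Lemma homeoR_mul_homo (f g : homeoR) : {homo g \o f : x y / x < y}.
Proof. by move=> x y xy; do 2! apply: homeoR_homo. Qed.

(* Actions are on the right: f * g is f followed by g. *)
Definition homeoR_mul (f g : homeoR) : homeoR :=
  mk_homeoR (@homeoR_mul_homo f g)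
    (can_comp (homeoR_invK g) (homeoR_invK f))
    (can_comp (homeoR_invVK f) (homeoR_invVK g)).

Fact homeoR_mulA : associative homeoR_mul.
Proof. by move=> f g h; exact: homeoR_eq. Qed.

Fact homeoR_mul1 : left_id homeoR_one homeoR_mul.
Proof. by move=> f; exact: homeoR_eq. Qed.

Fact homeoR_mulr1 : right_id homeoR_one homeoR_mul.
Proof. by move=> f; exact: homeoR_eq. Qed.

Fact homeoR_mulV : left_inverse homeoR_one homeoR_inv homeoR_mul.
Proof. by move=> f; apply: homeoR_eq => x; exact: homeoR_invVK. Qed.

Fact homeoR_mulrV : right_inverse homeoR_one homeoR_inv homeoR_mul.
Proof. by move=> f; apply: homeoR_eq => x; exact: homeoR_invK. Qed.

HB.instance Definition _ := isGroup.Build homeoR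
  homeoR_mulA homeoR_mul1 homeoR_mulr1 homeoR_mulV homeoR_mulrV.

Lemma homeoR1E x : (1%g : homeoR) x = x. Proof. by []. Qed.

Lemma homeoRME (f g : homeoR) x : (f * g)%g x = g (f x). Proof. by []. Qed.

Lemma homeoRVK (f : homeoR) : cancel f (f^-1)%g.
Proof. exact: homeoR_invK. Qed.

Lemma homeoRKV (f : homeoR) : cancel (f^-1)%g f.
Proof. exact: homeoR_invVK. Qed.

(* An orientation preserving homeomorphism of [0,1] is encoded as its
   extension to R by the identity. *)
Definition id_off01 : pred homeoR :=
  fun f => `[< forall x, ~~ (0 <= x <= 1) -> f x = x >].

Record homeoI := HomeoI {
  homeoI_homeoR :> homeoR;
  homeoI_subproof : id_off01 homeoI_homeoR
}.

HB.instance Definition _ := [isSub for homeoI_homeoR].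
HB.instance Definition _ := [Choice of homeoI by <:].

Fact id_off01_group_closed : group_closed id_off01.
Proof.
split; first exact/asboolP.
move=> f g /asboolP fI /asboolP gI; apply/asboolP => x xI.
by rewrite homeoRME fI// -[in LHS](gI x xI) homeoRVK.
Qed.

HB.instance Definition _ :=
  SubChoice_isSubGroup.Build homeoR id_off01 homeoI id_off01_group_closed.

Lemma homeoI_eq (f g : homeoI) : f =1 g -> f = g.
Proof. by move=> fg; apply/val_inj/homeoR_eq. Qed.

Lemma homeoI_out (f : homeoI) x : ~~ (0 <= x <= 1) -> f x = x.
Proof. by move: x; exact/asboolP/(valP f). Qed.

Lemma homeoIME (f g : homeoI) x : (f * g)%g x = g (f x). Proof. by []. Qed.

Lemma homeoIVK (f : homeoI) : cancel f (f^-1)%g.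
Proof. exact: (homeoRVK f). Qed.

Lemma homeoIKV (f : homeoI) : cancel (f^-1)%g f.
Proof. exact: (homeoRKV f). Qed.

Lemma homeoI_0 (f : homeoI) : f 0 = 0.
Proof.
have ge0 (h : homeoI) : 0 <= h 0.
  rewrite leNgt; apply/negP => h0.
  have := homeoR_homo h h0.
  by rewrite (@homeoI_out h (h 0)) ?ltxx// negb_and -!ltNge h0.
apply/eqP; rewrite eq_le ge0 andbT.
by rewrite leNgt -(homeoR_mono (f^-1)%g) homeoIVK -leNgt ge0.
Qed.

Lemma homeoI_1 (f : homeoI) : f 1 = 1.
Proof.
have le1 (h : homeoI) : h 1 <= 1.
  rewrite leNgt; apply/negP => h1.
  have := homeoR_homo h h1.
  by rewrite (@homeoI_out h (h 1)) ?ltxx// negb_and -!ltNge h1 orbT.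
apply/eqP; rewrite eq_le le1 /=.
by rewrite leNgt -(homeoR_mono (f^-1)%g) homeoIVK -leNgt le1.
Qed.

Lemma homeoI_itv (f : homeoI) x : 0 <= x < 1 -> 0 <= f x < 1.
Proof.
move=> /andP[x0 x1]; apply/andP; split.
  by rewrite -[X in X <= _](homeoI_0 f) leNgt homeoR_mono -leNgt.
by rewrite -[X in _ < X](homeoI_1 f) homeoR_mono.
Qed.

Fact iota_conj_homo (f : homeoI) :
  {homo (fun x : R => 1 - f (1 - x)) : x y / x < y}.
Proof. by move=> x y xy; rewrite ltrD2l ltrN2 homeoR_mono ltrD2l ltrN2. Qed.

Fact iota_conj_can (f g : homeoI) : cancel f g ->
  cancel (fun x : R => 1 - f (1 - x)) (fun x : R => 1 - g (1 - x)).
Proof. by move=> fg x; rewrite !subKr fg subKr. Qed.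

Definition iota_conjR (f : homeoI) : homeoR :=
  mk_homeoR (@iota_conj_homo f) (iota_conj_can (homeoIVK f))
    (iota_conj_can (homeoIKV f)).

Fact iota_conj_subproof (f : homeoI) : id_off01 (iota_conjR f).
Proof.
apply/asboolP => x xI /=; rewrite homeoI_out ?subKr//.
by apply: contra xI; lra.
Qed.

Definition iota_conj (f : homeoI) : homeoI := HomeoI (iota_conj_subproof f).

Lemma iota_conjE (f : homeoI) x : iota_conj f x = 1 - f (1 - x).
Proof. by []. Qed.

Definition supp (f : R -> R) : set R := [set x | f x <> x].

Definition dyadic : set R :=
  [set x | exists (m : int) (k : nat), x = m%:~R / 2 ^+ k].

(* 0 and 1 are dyadic, so only interior breakpoints matter. *)
Definition breakpoints (f : R -> R) : set R :=
  [set x | 0 < x < 1 /\ ~ derivable f x 1].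

Definition thompsonF : set homeoI :=
  [set f | [/\ finite_set (breakpoints f),
    forall u v : R, `]u, v[ `<=` `]0, 1[ `\` breakpoints f ->
      exists a b : R, {in `]u, v[, forall x, f x = a * x + b},
    breakpoints f `<=` dyadic &
    forall x : R, 0 < x < 1 -> derivable f x 1 ->
      exists k : int, derive1 f x = 2 ^ k]].

Definition thompsonF_on (r s : R) : set homeoI :=
  [set f | thompsonF f /\ supp f `<=` `[r, s]].

(* The homeomorphism that preserves every [a + n, a + n + 1], n in Z, and acts
   on it as the conjugate of f n by x |-> x + a + n; see tileE. *)
Definition tile_fun (a : R) (f : int -> homeoI) (x : R) : R :=
  let n := Num.floor (x - a) in a + n%:~R + f n (x - (a + n%:~R)).

Lemma tile_fun_floor a f x :
  Num.floor (tile_fun a f x - a) = Num.floor (x - a).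
Proof.
rewrite /tile_fun; have := floor_itv (x - a).
move: (Num.floor _) => n; rewrite intrD mulr1z => /andP[xn1 xn2].
have : 0 <= x - (a + n%:~R) < 1 by apply/andP; split; lra.
move=> /(homeoI_itv (f n)) /andP[h1 h2]; apply: floor_def; rewrite intrD mulr1z.
by apply/andP; split; lra.
Qed.

Fact tile_homo a f : {homo tile_fun a f : x y / x < y}.
Proof.
move=> x y xy.
have [nm|mn|nm] := ltgtP (Num.floor (x - a)) (Num.floor (y - a)).
- have h1 := floorD1_gt (tile_fun a f x - a).
  have h2 := floor_le (tile_fun a f y - a).
  rewrite !tile_fun_floor in h1 h2.
  move: nm; rewrite -lezD1 -(ler_int R) => nm; lra.
- have h1 := floorD1_gt (y - a); have h2 := floor_le (x - a).
  move: mn; rewrite -lezD1 -(ler_int R) => mn; lra.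
- by rewrite /tile_fun nm ltrD2l homeoR_mono ltrD2r.
Qed.

Fact tile_can a (f g : int -> homeoI) : (forall n, cancel (f n) (g n)) ->
  cancel (tile_fun a f) (tile_fun a g).
Proof.
move=> fg x; rewrite [LHS]/tile_fun tile_fun_floor /tile_fun.
by rewrite [X in g _ X]addrC addKr fg addrC subrK.
Qed.

Definition tile (a : R) (f : int -> homeoI) : homeoR :=
  mk_homeoR (@tile_homo a f)
    (@tile_can a f (fun n => (f n)^-1)%g (fun n => homeoIVK (f n)))
    (@tile_can a (fun n => (f n)^-1)%g f (fun n => homeoIKV (f n))).

Lemma tileE a f (n : int) x : a + n%:~R <= x <= a + n%:~R + 1 ->
  tile a f x = a + n%:~R + f n (x - (a + n%:~R)).
Proof.
move=> /andP[nx]; rewrite le_eqVlt => /predU1P[->|xn].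
  have fl : Num.floor (a + n%:~R + 1 - a) = n + 1.
    by apply: floor_def; rewrite !intrD mulr1z; apply/andP; split; lra.
  rewrite /= /tile_fun fl intrD mulr1z addrA subrr homeoI_0 addr0.
  by rewrite [X in f n X]addrAC subrr add0r homeoI_1.
rewrite /= /tile_fun.
by rewrite (@floor_def _ _ n) //; rewrite intrD mulr1z; apply/andP; split; lra.
Qed.

End HomeoR.

Inductive letter := La | LaV | Lb | LbV.

Definition letter_code (l : letter) : bool * bool :=
  match l with
  | La => (false, false) | LaV => (false, true)
  | Lb => (true, false) | LbV => (true, true)
  end.

Definition letter_decode (c : bool * bool) : letter :=
  match c with
  | (false, false) => La | (false, true) => LaV
  | (true, false) => Lb | (true, true) => LbV
  end.

Fact letter_codeK : cancel letter_code letter_decode. Proof. by case. Qed.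

HB.instance Definition _ := Equality.copy letter (can_type letter_codeK).

Definition letter_inv (l : letter) : letter :=
  match l with La => LaV | LaV => La | Lb => LbV | LbV => Lb end.

(* A labelling of (1/2)Z is a map on int: rho j is the label of j/2. *)
Definition labelling (rho : int -> letter) : Prop :=
  forall n : int,
    rho (2 * n) \in [:: La; LaV] /\ rho (2 * n + 1) \in [:: Lb; LbV].

(* The word of the block of n + 1 points j/2, j/2 + 1/2, ..., j/2 + n/2. *)
Definition block_word (rho : int -> letter) (j : int) (n : nat) : seq letter :=
  mkseq (fun i => rho (j + i%:Z)) n.+1.

Definition word_inv (w : seq letter) : seq letter := rev (map letter_inv w).

Definition quasi_periodic (rho : int -> letter) : Prop :=
  (forall (j : int) (m : nat), exists n : nat,
     forall (k : int) (p : nat), (n <= p.+1)%N ->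
       infix (block_word rho j m) (block_word rho k p)) /\
  (forall (j : int) (m : nat), exists (k : int) (p : nat),
     block_word rho k p = word_inv (block_word rho j m)).

Section GroupGrho.
Variables (R : realType) (rho : int -> letter).

Definition zeta (nu : homeoI R) : homeoR R :=
  tile 0 (fun n => if rho (2 * n + 1) == Lb then nu else iota_conj nu).

Definition chi (nu : homeoI R) : homeoR R :=
  tile (- 2^-1) (fun n => if rho (2 * n) == La then nu else iota_conj nu).

Definition G_rho (nu1 nu2 nu3 : homeoI R) : set (homeoR R) :=
  generated [set zeta nu1; zeta nu2; zeta nu3; chi nu1; chi nu2; chi nu3].

End GroupGrho.

(* Main.v *)
Require Import Defs.
From HB Require Import structures.
From mathcomp Require Import all_boot all_order all_algebra.
From mathcomp Require Import all_classical all_reals all_analysis.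
From mathcomp Require Import lra ring zify.
Set Implicit Arguments.
Unset Strict Implicit.
Unset Printing Implicit Defensive.
Import Order.TTheory GRing.Theory Num.Theory.
Import numFieldNormedType.Exports.
Local Open Scope classical_set_scope.
Local Open Scope ring_scope.

(* On each half-unit cell of the line let a compactly supported
   dyadic PL homeomorphism f of [0, 1/2] act, at once on all the cells of a set A
   described by finitely many labels around the cell.  Commutators turn the
   actions on A and B into actions on the intersection of A and B, and
   conjugation by zeta(g) or chi(g) moves A to the adjacent cells, so starting
   from one label all such local actions belong to the group; here the group of
   compactly supported PL homeomorphisms has to be perfect.  That perfectness
   follows from the two-generation of F_[1/16, 15/16]: the slopes at the two end
   points map its abelianization, which has at most two generators, onto Z^2.

   Elements of the group are local: the action near x depends on finitely many
   labels near x, with reversed labels giving the reflected action.  Since every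
   word occurs reversed, no nontrivial element is a translation, hence a
   nontrivial h moves some point out of its orbit under the isometries
   x |-> n + x and x |-> n - x.  Double commutators with h then produce, in the
   normal closure of h, the local actions on the cells surrounded by one fixed
   word.  As this word occurs syndetically, finitely many neighbour moves spread
   these actions to all cells, and so to all generators. *)

(** The local actions fed into the double commutator act on all cells with a given window at once,
    so none of them is confined to one small interval. The element h must therefore move an interval
    off all of its copies under x |-> n + x and x |-> n - x; this is why some point has to leave its
    whole orbit under this infinite dihedral group, rather than merely be moved. Locality is what
    makes h the same map, in cell coordinates, on all cells of the window. The generator [nu1] needs
    separate care, since its slope 2 at both ends of [0, 1] keeps it outside the compactly supported
    groups. Two properties make up for this. Its powers repel points from 0 and 1, so they conjugate
    every compactly supported element of the unit interval into [1/16, 15/16], where [nu2] and [nu3]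
    generate. Being symmetric, it ignores the exponents of the labels, and its action on one tiling
    is a compactly supported action on the tiles of the other. Thompson's condition is traded for a
    local one, preservation of dyadic points and one-sided slopes that are powers of 2, because
    products and inverses are then immediate. *)

Section Groups.
Variable gT : groupType.
Implicit Types (S G H N : set gT) (x y : gT).

Lemma subgroup1 G : subgroup G -> G 1%g.
Proof. by case=> /set_mem. Qed.

Lemma subgroupMV G x y : subgroup G -> G x -> G y -> G (x / y)%g.
Proof. by case=> _ GM Gx Gy; apply/set_mem/GM; exact/mem_set. Qed.

Lemma subgroupV G x : subgroup G -> G x -> G x^-1%g.
Proof. by move=> GG Gx; rewrite -div1g; apply: subgroupMV => //; exact: subgroup1. Qed.

Lemma subgroupM G x y : subgroup G -> G x -> G y -> G (x * y)%g.
Proof.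
by move=> GG Gx Gy; rewrite -[y]invgK; apply: subgroupMV => //; exact: subgroupV.
Qed.

Lemma subgroupJ G x y : subgroup G -> G x -> G y -> G (x ^ y)%g.
Proof. by move=> GG Gx Gy; do ![apply: subgroupM => //]; exact: subgroupV. Qed.

Lemma subgroupR G x y : subgroup G -> G x -> G y -> G [~ x, y]%g.
Proof.
by move=> GG Gx Gy; apply: subgroupM => //; [exact: subgroupV|exact: subgroupJ].
Qed.

Lemma mk_subgroup G :
  G 1%g -> (forall x y, G x -> G y -> G (x / y)%g) -> subgroup G.
Proof.
move=> G1 GM; split=> [|x y /set_mem Gx /set_mem Gy]; apply/mem_set => //.
exact: GM.
Qed.

Lemma sub_generated S : S `<=` generated S.
Proof. exact: sub_smallest. Qed.

Lemma generated_subgroup S : subgroup (generated S).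
Proof.
apply: mk_subgroup => [H [HG _]|x y Gx Gy H HS]; first exact: subgroup1.
by apply: subgroupMV; [case: HS|exact: Gx|exact: Gy].
Qed.

Lemma generated_min S H : subgroup H -> S `<=` H -> generated S `<=` H.
Proof. by move=> HH SH x; apply. Qed.

Lemma normalJ N G x g : normal_subgroup N G -> N x -> G g -> N (x ^ g)%g.
Proof. by case=> _ _; apply. Qed.

Lemma normalR N G x g :
  subgroup G -> normal_subgroup N G -> N x -> G g -> N [~ x, g]%g.
Proof.
move=> GG NG Nx Gg; have [NN _ _] := NG.
by apply: subgroupM => //; [exact: subgroupV|exact: normalJ NG _ _].
Qed.

Lemma normalRr N G x g :
  subgroup G -> normal_subgroup N G -> N x -> G g -> N [~ g, x]%g.
Proof.
move=> GG NG Nx Gg; have [NN _ _] := NG.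
by rewrite -invgR; apply: subgroupV => //; exact: normalR NG _ _.
Qed.

End Groups.

(** * Dyadic rationals: closure properties and density *)

Section Dyadic.
Variable R : realType.
Implicit Types x y : R.

Lemma dyadic_int (m : int) : dyadic (m%:~R : R).
Proof. by exists m, 0%N; rewrite expr0 divr1. Qed.

Lemma dyadicN x : dyadic x -> dyadic (- x).
Proof. by move=> [m [k ->]]; exists (- m), k; rewrite mulrNz mulNr. Qed.

Lemma dyadicD x y : dyadic x -> dyadic y -> dyadic (x + y).
Proof.
move=> [m [k ->]] [n [l ->]]; exists (m * 2 ^+ l + n * 2 ^+ k), (k + l)%N.
rewrite intrD !intrM !rmorphXn /= exprD.
have h2 i : (2 : R) ^+ i != 0 by rewrite expf_neq0.
by field; rewrite !h2.
Qed.

Lemma dyadicB x y : dyadic x -> dyadic y -> dyadic (x - y).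
Proof. by move=> dx dy; apply: dyadicD => //; exact: dyadicN. Qed.

Lemma dyadicZ (k : int) x : dyadic x -> dyadic (2 ^ k * x).
Proof.
have h2 i : (2 : R) ^+ i != 0 by rewrite expf_neq0.
move=> [m [l ->]]; case: k => k.
  exists (m * 2 ^+ k), l; rewrite intrM rmorphXn /= -exprnP.
  by field; rewrite h2.
by exists m, (l + k.+1)%N; rewrite NegzE -exprnN exprD; field; rewrite !h2.
Qed.

Lemma dyadicZE (k : int) x : dyadic (2 ^ k * x) <-> dyadic x.
Proof.
split; last exact: dyadicZ.
by move=> /(dyadicZ (- k)); rewrite mulrA -expfzDr// addNr expr0z mul1r.
Qed.

Lemma dyadicDE x y : dyadic x -> dyadic (x + y) <-> dyadic y.
Proof.
move=> dx; split=> [|dy]; last exact: dyadicD.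
by move=> /dyadicB /(_ dx); rewrite addrC addKr.
Qed.

Lemma dyadicNE x : dyadic (- x) <-> dyadic x.
Proof. by split=> /dyadicN; rewrite ?opprK. Qed.

Lemma exp2_lt x : 0 < x -> exists k : nat, 2 ^- k < x.
Proof.
move=> x0; exists (Num.truncn x^-1).+1.
rewrite -[ltRHS]invrK ltf_pV2 ?posrE ?exprn_gt0 ?invr_gt0//.
have := truncnS_gt x^-1 => /lt_trans; apply.
by rewrite -natrX ltr_nat; exact: ltn_expl.
Qed.

Lemma dyadic_dense x y : x < y -> exists2 z, dyadic z & x < z < y.
Proof.
rewrite -subr_gt0 => /exp2_lt[k kxy].
pose m := Num.floor (x * 2 ^+ k) + 1.
have h2 : (0 : R) < 2 ^+ k by rewrite exprn_gt0.
exists (m%:~R / 2 ^+ k); first by exists m, k.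
rewrite ltr_pdivlMr// ltr_pdivrMr// floorD1_gt/= intrD mulr1z.
have /andP[fl _] := floor_itv (x * 2 ^+ k).
have : 1 < (y - x) * 2 ^+ k by rewrite -ltr_pdivrMr// div1r.
lra.
Qed.

End Dyadic.

(** * A local form of dyadic piecewise linearity *)

Section PiecewiseLinear.
Variable R : realType.
Implicit Types (x y t d : R) (k l : int).

Definition local_slopes (f : R -> R) x k l d : Prop :=
  forall t, 0 <= t < d -> f (x + t) = f x + 2 ^ k * t /\ f (x - t) = f x - 2 ^ l * t.

(** The conditions are local, so they pass to composites without counting breakpoints; finiteness is
    recovered later on [0, 1]. Preservation of dyadic points belongs here because a breakpoint of
    [g \o f] at x may come from a breakpoint of g at [f x]. *)
Definition is_PL (f : R -> R) : Prop :=
  (forall x, dyadic x <-> dyadic (f x)) /\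
  forall x, exists d k l,
    [/\ 0 < d, dyadic x \/ k = l & local_slopes f x k l d].

Lemma PL_id : is_PL id.
Proof.
split=> // x; exists 1, 0, 0; split => //; first by right.
by move=> t _; rewrite expr0z !mul1r.
Qed.

Lemma PL_comp (f g : R -> R) : is_PL f -> is_PL g -> is_PL (g \o f).
Proof.
move=> [fd fl] [gd gl]; split=> [x|x]; first exact: iff_trans (fd x) (gd _).
have [d1 [k1 [l1 [d10 s1 f1]]]] := fl x.
have [d2 [k2 [l2 [d20 s2 g2]]]] := gl (f x).
have k10 : (0 : R) < 2 ^ k1 by rewrite exprz_gt0.
have l10 : (0 : R) < 2 ^ l1 by rewrite exprz_gt0.
exists (Num.min d1 (Num.min (d2 / 2 ^ k1) (d2 / 2 ^ l1))), (k1 + k2), (l1 + l2).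
split.
- by rewrite !lt_min d10 !divr_gt0.
- case: s1 => [dx|->]; first by left.
  case: s2 => [dfx|->]; last by right.
  by left; apply/fd.
- move=> t; rewrite !lt_min !ltr_pdivlMr// => /and4P[t0 td1 td2 td3] /=.
  have [-> ->] := f1 _ (introT andP (conj t0 td1)).
  have e i j : 2 ^ (i + j) * t = 2 ^ j * (2 ^ i * t).
    by rewrite expfzDr// mulrAC mulrC.
  rewrite !e; split.
    by apply: (g2 _ _).1; rewrite mulr_ge0 ?(ltW k10)//= mulrC.
  by apply: (g2 _ _).2; rewrite mulr_ge0 ?(ltW l10)//= mulrC.
Qed.

Lemma PL_can (f g : R -> R) : cancel f g -> cancel g f -> is_PL f -> is_PL g.
Proof.
move=> fg gf [fd fl]; split=> [y|y].
  by rewrite -{1}(gf y); apply: iff_sym.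
have [d [k [l [d0 s f1]]]] := fl (g y).
have k0 : (0 : R) < 2 ^ k by rewrite exprz_gt0.
have l0 : (0 : R) < 2 ^ l by rewrite exprz_gt0.
have h m t : 2 ^ m * (2 ^ (- m) * t) = t by rewrite mulrA -expfzDr// subrr expr0z mul1r.
exists (Num.min (d * 2 ^ k) (d * 2 ^ l)), (- k), (- l); split.
- by rewrite lt_min !mulr_gt0.
- case: s => [|->]; last by right.
  by move=> /fd; rewrite gf; left.
- move=> t; rewrite lt_min => /and3P[t0 tk tl].
  have m0 m : (0 : R) < 2 ^ m by rewrite exprz_gt0.
  split; apply: (can_inj fg); rewrite gf.
    rewrite (f1 _ _).1 ?h ?gf//.
    by rewrite mulr_ge0 ?(ltW (m0 _))//= -invr_expz mulrC ltr_pdivrMr.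
  rewrite (f1 _ _).2 ?h ?gf//.
  by rewrite mulr_ge0 ?(ltW (m0 _))//= -invr_expz mulrC ltr_pdivrMr.
Qed.

Lemma PL_affine k c : dyadic c -> is_PL (fun x => 2 ^ k * x + c).
Proof.
move=> dc; split=> x.
  by apply: iff_trans (iff_sym (dyadicZE k x)) _; rewrite addrC; apply: iff_sym; exact: dyadicDE.
by exists 1, k, k; split => //; [right|move=> t _; split; ring].
Qed.

Lemma PL_refl (f : R -> R) c :
  dyadic c -> is_PL f -> is_PL (fun x => c - f (c - x)).
Proof.
move=> dc [fd fl]; split=> x.
  have h y : dyadic y <-> dyadic (c - y).
    by apply: iff_trans (iff_sym (dyadicNE y)) _; apply: iff_sym; exact: dyadicDE.
  by apply: iff_trans (h x) _; apply: iff_trans (fd _) _; exact: h.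
have [d [k [l [d0 s f1]]]] := fl (c - x).
exists d, l, k; split => //.
  case: s => [dx|]; [left|by right].
  by move: dx => /dyadicDE-/(_ dc)/dyadicNE.
move=> t /f1[h1 h2]; split.
  by rewrite opprD addrA h2; lra.
by rewrite opprB (addrCA c) (addrC t) h1; lra.
Qed.

End PiecewiseLinear.

(** * Affine maps, reflections and supports *)

Section Homeomorphisms.
Variable R : realType.
Implicit Types (f g h : homeoR R) (x y : R).

Lemma PL_subgroup : subgroup [set f : homeoR R | is_PL f].
Proof.
apply: mk_subgroup => [|f g /= Pf Pg]; first exact: PL_id.
apply: (@PL_comp _ f (g^-1)%g) => //.
exact: PL_can (homeoRVK g) (homeoRKV g) Pg.
Qed.

Fact affine_homo (k : int) (c : R) : {homo (fun x => 2 ^ k * x + c) : x y / x < y}.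
Proof. by move=> x y xy; rewrite ltrD2r ltr_pM2l// exprz_gt0. Qed.

Fact affine_can (k : int) (c : R) :
  cancel (fun x => 2 ^ k * x + c) (fun x => 2 ^ (- k) * (x - c)).
Proof. by move=> x; rewrite addrK mulrA -expfzDr// addNr expr0z mul1r. Qed.

Fact affine_canV (k : int) (c : R) :
  cancel (fun x => 2 ^ (- k) * (x - c)) (fun x => 2 ^ k * x + c).
Proof. by move=> x; rewrite mulrA -expfzDr// subrr expr0z mul1r subrK. Qed.

Definition affine (k : int) (c : R) : homeoR R :=
  mk_homeoR (@affine_homo k c) (@affine_can k c) (@affine_canV k c).

Lemma affineE k c x : affine k c x = 2 ^ k * x + c. Proof. by []. Qed.

Lemma conjg_affine f k c x : (f ^ affine k c)%g x = 2 ^ k * f (2 ^ (- k) * (x - c)) + c.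
Proof.
rewrite conjgE 2!homeoRME affineE; congr (_ * f _ + _).
by apply: (can_inj (affine_can k c)); rewrite affine_canV -affineE homeoRKV.
Qed.

Lemma affine_PL k c : dyadic c -> is_PL (affine k c).
Proof. exact: PL_affine. Qed.

Fact reflect_homo c f : {homo (fun x => c - f (c - x)) : x y / x < y}.
Proof. by move=> x y xy; rewrite ltrD2l ltrN2 homeoR_mono ltrD2l ltrN2. Qed.

Fact reflect_can c f g : cancel f g ->
  cancel (fun x => c - f (c - x)) (fun x => c - g (c - x)).
Proof. by move=> fg x; rewrite !subKr fg subKr. Qed.

(** Conjugation by the reflection x |-> c - x; [mirror 1] extends [iota_conj]. *)
Definition mirror (c : R) f : homeoR R :=
  mk_homeoR (@reflect_homo c f) (@reflect_can c f f^-1%g (homeoRVK f))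
    (@reflect_can c f^-1%g f (homeoRKV f)).

Lemma mirrorE c f x : mirror c f x = c - f (c - x). Proof. by []. Qed.

Lemma mirrorK c : involutive (mirror c).
Proof. by move=> f; apply: homeoR_eq => x; rewrite !mirrorE !subKr. Qed.

Lemma mirror_PL c f : dyadic c -> is_PL f -> is_PL (mirror c f).
Proof. exact: PL_refl. Qed.

Lemma homeoR_le_mono f : {mono f : x y / x <= y}.
Proof. exact/le_mono/homeoR_homo. Qed.

Definition supported (p q : R) f : Prop := forall x, ~~ (p <= x <= q) -> f x = x.

Lemma supported_sub p q p' q' f :
  p' <= p -> q <= q' -> supported p q f -> supported p' q' f.
Proof.
move=> pp qq fs x xI; apply: fs; apply: contra xI => /andP[px xq].
by rewrite (le_trans pp px) (le_trans xq qq).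
Qed.

Lemma supported_subgroup p q : subgroup [set f | supported p q f].
Proof.
apply: mk_subgroup => // f g /= fs gs x xI.
by rewrite homeoRME (fs _ xI) -{1}(gs _ xI) homeoRVK.
Qed.

(** If g sent p below itself, the midpoint of [g p] and p would be fixed, which contradicts
    monotonicity. Applying this to f and to its inverse gives both inequalities. *)
Lemma supported_end p q f : p <= q -> supported p q f -> f p = p /\ f q = q.
Proof.
move=> pq; have ends g : supported p q g -> p <= g p /\ g q <= q.
  move=> gs; split; rewrite leNgt; apply/negP => lt.
    have /(@homeoR_homo _ g) : (g p + p) / 2 < p by lra.
    by rewrite gs; [|apply/negP]; lra.
  have /(@homeoR_homo _ g) : q < (g q + q) / 2 by lra.
  by rewrite (gs ((g q + q) / 2)); [|apply/negP]; lra.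
move=> fs; have [fp fq] := ends _ fs.
have [gp gq] := ends _ (subgroupV (supported_subgroup p q) fs).
split; apply/eqP; rewrite eq_le ?fp ?fq ?andbT/=.
  by rewrite -(homeoR_le_mono f^-1%g) homeoRVK.
by rewrite -(homeoR_le_mono f^-1%g) homeoRVK.
Qed.

Lemma supported_itv p q f x : p <= q -> supported p q f -> (p <= f x <= q) = (p <= x <= q).
Proof.
move=> pq fs; have [fp fq] := supported_end pq fs.
by rewrite -[X in X <= f x]fp -[X in f x <= X]fq !homeoR_le_mono.
Qed.

Lemma supported_conj p q f g : supported p q f -> supported (g p) (g q) (f ^ g)%g.
Proof.
move=> fs x xI; rewrite conjgE 2!homeoRME fs ?homeoRKV//; apply: contra xI.
by rewrite -(homeoR_le_mono g) -(homeoR_le_mono g _ q) homeoRKV.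
Qed.

Lemma supported_mirror c p q f :
  supported p q f -> supported (c - q) (c - p) (mirror c f).
Proof.
move=> fs x xI; rewrite mirrorE fs ?subKr//; apply: contra xI; lra.
Qed.

Lemma mirrorM c f g : mirror c (f * g)%g = (mirror c f * mirror c g)%g.
Proof. by apply: homeoR_eq => x; rewrite homeoRME !mirrorE subKr. Qed.

(** The support keeps away from u and v: nontrivial slopes at the end points would survive in the
    abelianization and exclude perfectness. *)
Definition PLc (u v : R) : set (homeoR R) :=
  [set f : homeoR R | is_PL f /\ exists p q, [/\ u < p, p <= q, q < v & supported p q f]].

Lemma PLc_sub u v u' v' : u' <= u -> v <= v' -> PLc u v `<=` PLc u' v'.
Proof.
move=> uu vv f [fP [p [q [up pq qv fs]]]]; split=> //; exists p, q; split=> //.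
  exact: le_lt_trans up.
exact: lt_le_trans vv.
Qed.

Lemma PLc_supported u v f : PLc u v f -> supported u v f.
Proof. by move=> [_ [p [q [up pq qv]]]]; apply: supported_sub; exact: ltW. Qed.

Lemma PLc_subgroup u v : u < v -> subgroup (PLc u v).
Proof.
move=> uv; apply: mk_subgroup.
  split; first exact: (subgroup1 PL_subgroup).
  by exists ((u + v) / 2), ((u + v) / 2); split=> //; lra.
move=> f g [fP [p [q [up pq qv fs]]]] [gP [p' [q' [up' pq' qv' gs]]]].
split; first exact: (subgroupMV PL_subgroup).
exists (Num.min p p'), (Num.max q q').
split; [by rewrite lt_min up up'|by rewrite ge_min le_max pq|by rewrite gt_max qv qv'|].
apply: (subgroupMV (supported_subgroup _ _)).
  by apply: supported_sub fs; rewrite ?ge_min ?le_max lexx.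
by apply: supported_sub gs; rewrite ?ge_min ?le_max lexx orbT.
Qed.

Lemma PLc_conj u v g f : is_PL g -> PLc u v f -> PLc (g u) (g v) (f ^ g)%g.
Proof.
move=> gP [fP [p [q [up pq qv fs]]]].
split; first exact: (subgroupJ PL_subgroup).
exists (g p), (g q); split; rewrite ?homeoR_mono ?homeoR_le_mono//.
exact: supported_conj.
Qed.

Lemma PLc_mirror c u v f :
  dyadic c -> PLc u v f -> PLc (c - v) (c - u) (mirror c f).
Proof.
move=> dc [fP [p [q [up pq qv fs]]]]; split; first exact: mirror_PL.
by exists (c - q), (c - p); split; [lra|lra|lra|exact: supported_mirror].
Qed.

Lemma commute_disjoint f g : (forall x, f x = x \/ g x = x) -> commute f g.
Proof.
move=> fg; apply: homeoR_eq => x; rewrite !homeoRME.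
have inj (h : homeoR R) : injective h by exact: can_inj (homeoRVK h).
case: (fg x) => [fx|gx].
  case: (fg (g x)) => [->|/inj gx]; first by rewrite fx.
  by rewrite fx gx fx.
case: (fg (f x)) => [/inj fx|->]; first by rewrite fx gx fx.
by rewrite gx.
Qed.

End Homeomorphisms.

(** * Derived groups and the displacement identity for commutators *)

Section Commutators.
Variable gT : groupType.
Implicit Types (S T H : set gT).

Definition derived S : set gT :=
  generated [set z | exists x y, [/\ S x, S y & z = [~ x, y]%g]].

Lemma derived_min S H :
  subgroup H -> (forall x y, S x -> S y -> H [~ x, y]%g) -> derived S `<=` H.
Proof. by move=> HH SH; apply: generated_min => // _ [x [y [Sx Sy ->]]]; exact: SH. Qed.

Lemma derivedR S x y : S x -> S y -> derived S [~ x, y]%g.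
Proof. by move=> Sx Sy; apply: sub_generated; exists x, y. Qed.

Lemma derived_subgroup S : subgroup (derived S).
Proof. exact: generated_subgroup. Qed.

Lemma preim_conj_subgroup H h : subgroup H -> subgroup [set x | H (x ^ h)%g].
Proof.
move=> HH; apply: mk_subgroup => [|x y /= Hx Hy].
  by rewrite /= conj1g; exact: subgroup1.
by rewrite conjMg conjVg; exact: subgroupMV.
Qed.

Lemma derived_conj S T h x :
  (forall y, S y -> T (y ^ h)%g) -> derived S x -> derived T (x ^ h)%g.
Proof.
move=> ST; move: x; apply: derived_min.
  exact: preim_conj_subgroup (derived_subgroup T).
by move=> x y Sx Sy /=; rewrite conjRg; apply: derivedR; exact: ST.
Qed.

(* The hypotheses hold when h moves the support of a off those of a and c. *)
Lemma displaced_commutator (a c h : gT) :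
  commute (a ^ h)%g a -> commute (a ^ h)%g c -> [~ [~ a^-1, h], c]%g = [~ a, c]%g.
Proof.
move=> ha hc; rewrite [X in [~ X, _]%g]commgEl invgK conjVg.
move: (a ^ h)%g ha hc => b ha hc.
have comm x : commute b x -> (x ^ b^-1)%g = x.
  by move=> bx; apply/conjg_fixP/commgP/commuteV/commute_sym.
have -> : [~ a / b, c]%g = ([~ a, c] ^ b^-1 * [~ b^-1, c])%g.
  by rewrite !commgEl !conjgE !invgM !invgK !mulgA !mulgVK !mulgK.
rewrite conjRg !comm// (_ : [~ b^-1, c]%g = 1%g) ?mulg1//.
by apply/eqP/commgP/commute_sym/commuteV/commute_sym.
Qed.

End Commutators.

Lemma sup_adherent_lt (R : realType) (E : set R) (y : R) :
  has_sup E -> y < sup E -> exists2 x, E x & y < x.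
Proof.
by move=> supE; rewrite -subr_gt0 => /sup_adherent/(_ supE)[x Ex]; rewrite subKr; exists x.
Qed.

(** * Moving compact sets by compactly supported maps, and spreading perfectness to all intervals *)

Section Transitivity.
Variables (R : realType) (b : homeoR R) (w : R).
Hypotheses (bPL : is_PL b) (w0 : 0 < w) (bsupp : supported 0 w b).
Hypothesis bgt : forall x, 0 < x < w -> x < b x.
Implicit Types (f g h : homeoR R) (u v x y : R).

Lemma bump_at u v x : u < x < v -> exists2 g, PLc u v g & x < g x.
Proof.
move=> /andP[ux xv].
have /exp2_lt[k] : 0 < Num.min (x - u) (v - x) / w.
  by rewrite divr_gt0// lt_min; apply/andP; split; lra.
rewrite ltr_pdivlMr// lt_min => /andP[kl kr].
have kw : 0 < 2 ^- k * w by rewrite mulr_gt0// invr_gt0 exprn_gt0.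
have [d dd /andP[dl dr]] := @dyadic_dense R (x - 2 ^- k * w) x ltac:(lra).
(* This copy of [b] lives on [d, d + 2^-k w], an interval inside (u, v) with x in its interior. *)
exists (b ^ affine (- k%:Z) d)%g.
  split.
    apply: (subgroupJ (PL_subgroup R)) => //; exact: affine_PL.
  exists (affine (- k%:Z) d 0), (affine (- k%:Z) d w).
  rewrite homeoR_le_mono (ltW w0) !affineE mulr0 add0r -exprnN; split=> //; [lra|lra|].
  have := supported_conj (g := affine (- k%:Z) d) bsupp.
  by rewrite !affineE mulr0 add0r -exprnN.
rewrite -{1}(@affine_canV R (- k%:Z) d x) conjg_affine ltrD2r ltr_pM2l ?exprz_gt0//.
apply: bgt; rewrite opprK -exprnP.
have k0 : (0 : R) < 2 ^+ k by rewrite exprn_gt0.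
apply/andP; split; first by apply: mulr_gt0 => //; lra.
by rewrite mulrC -ltr_pdivlMr// mulrC; lra.
Qed.

(** The orbit of x under [PLc u v] has supremum v: at a smaller supremum a bump would push nearby
    orbit points beyond it. *)
Lemma push_right u v x y : u < x < v -> y < v -> exists2 g, PLc u v g & y < g x.
Proof.
move=> /andP[ux xv] yv; have uv := lt_trans ux xv.
pose S := [set g x | g in PLc u v].
have Sx : S x by exists 1%g => //; exact: (subgroup1 (PLc_subgroup uv)).
have Sv z : S z -> z < v.
  move=> [g /PLc_supported gs <-].
  by have [_ gv] := supported_end (ltW uv) gs; rewrite -gv homeoR_mono.
have supS : has_sup S by split; [exists x|exists v => z /Sv/ltW].
have [ys|sy] := ltP y (sup S).
  by have [_ [g gP <-] yg] := sup_adherent_lt supS ys; exists g.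
have xs : x <= sup S by exact: (ub_le_sup supS.2).
have [g gP gs] : exists2 g, PLc u v g & sup S < g (sup S).
  by apply: bump_at; apply/andP; split; lra.
have : g^-1%g (sup S) < sup S by rewrite -(homeoR_mono g) homeoRKV.
move=> /(sup_adherent_lt supS)[_ [h hP <-]].
rewrite -(homeoR_mono g) homeoRKV ltNge => /negP[].
apply: (ub_le_sup supS.2); exists (h * g)%g => //.
exact: (subgroupM (PLc_subgroup uv)).
Qed.

Lemma push_left u v x y : u < x < v -> u < y -> exists2 g, PLc u v g & g x < y.
Proof.
move=> /andP[ux xv] uy.
have [||g gP gx] := @push_right (- v) (- u) (- x) (- y); first by apply/andP; split; lra.
  by lra.
exists (mirror 0 g); last by rewrite mirrorE !sub0r; lra.
have := PLc_mirror (@dyadic_int R 0) gP.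
by rewrite mulr0z !sub0r !opprK.
Qed.

(** Once q has been pulled below s, p can be pushed beyond r by a map supported inside (u, s), which
    keeps the image of q below s. *)
Lemma contract u v p q r s : u < p -> p <= q -> q < v -> u <= r -> r < s -> s <= v ->
  exists g, [/\ PLc u v g, r < g p & g q < s].
Proof.
move=> up pq qv ur rs sv; have uv : u < v by lra.
have [||g gP gq] := @push_left u v q s; [apply/andP; split; lra|lra|].
have [gu gv] := supported_end (ltW uv) (PLc_supported gP).
have gpu : u < g p by rewrite -gu homeoR_mono.
have gpq : g p <= g q by rewrite homeoR_le_mono.
have [||h hP hp] := @push_right u s (g p) r; [apply/andP; split; lra|lra|].
have [_ hs] := supported_end (ltW (le_lt_trans ur rs)) (PLc_supported hP).
exists (g * h)%g; split => //.
  apply: (subgroupM (PLc_subgroup uv)) => //.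
  exact: PLc_sub hP.
by rewrite homeoRME -hs homeoR_mono.
Qed.

Lemma conj_into u v r s f : PLc u v f -> u <= r -> r < s -> s <= v ->
  exists2 g, PLc u v g & PLc r s (f ^ g)%g.
Proof.
move=> [fP [p [q [up pq qv fs]]]] ur rs sv.
have [g [gP rp qs]] := contract up pq qv ur rs sv.
exists g => //; split; first by apply: (subgroupJ (PL_subgroup R)) => //; case: gP.
by exists (g p), (g q); rewrite homeoR_le_mono; split => //; exact: supported_conj.
Qed.

Hypothesis perfect0 :
  PLc (1 / 16) (15 / 16) `<=` derived (PLc 0 1 : set (homeoR R)).

Lemma PLc_perfect u v : u < v -> PLc u v `<=` derived (PLc u v : set (homeoR R)).
Proof.
move=> uv f fP; have Guv := PLc_subgroup uv.
(* With 2^-k < (v - u) / 2 and u < d < (u + v) / 2 the map [A] sends [0, 1] into (u, v), so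
   [perfect0] can be transported there. *)
have [k kuv] := @exp2_lt R ((v - u) / 2) ltac:(lra).
have [d dd /andP[ud dv]] := @dyadic_dense R u ((u + v) / 2) ltac:(lra).
pose A := affine (- k%:Z) d.
have AP : is_PL A by exact: affine_PL.
have k0 : (0 : R) < 2 ^- k by rewrite invr_gt0 exprn_gt0.
have A0 : A 0 = d by rewrite affineE mulr0 add0r.
have A1 : A 1 = 2 ^- k + d by rewrite affineE mulr1 -exprnN.
have [|||g gP] := @conj_into u v (A (1 / 16)) (A (15 / 16)) f fP.
- by apply: (le_trans (ltW ud)); rewrite -A0 homeoR_le_mono; lra.
- by rewrite homeoR_mono; lra.
- have : A (15 / 16) <= A 1 by rewrite homeoR_le_mono; lra.
  by rewrite A1; lra.
move=> /(PLc_conj (subgroupV (PL_subgroup R) AP)).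
rewrite !homeoRVK -conjgM => /perfect0.
move=> /(@derived_conj _ _ (PLc u v) (g / A)^-1%g); rewrite conjgK; apply.
rewrite invgM invgK => h hP; rewrite conjgM; apply: (subgroupJ Guv); last exact: subgroupV.
have := PLc_conj AP hP; rewrite A0 A1; apply: PLc_sub; lra.
Qed.

End Transitivity.

(** * Equivalence of the local form with membership in Thompson's group *)

Section ThompsonPL.
Variable R : realType.
Implicit Types (x y u v d a b : R) (k l : int).

(** Take the supremum of the initial segments on which P holds. This plays the role of compactness
    and connectedness arguments below. *)
Lemma real_induction (P : R -> Prop) (a : R) :
  (forall x, x < a -> P x) ->
  (forall x, (forall y, y < x -> P y) -> exists2 d, 0 < d & forall y, y < x + d -> P y) ->
  forall x, P x.
Proof.
move=> Pa step; apply: contrapT => /existsNP[x nPx].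
pose S := [set a | forall y, y < a -> P y].
have Sx z : S z -> z <= x by move=> Sz; rewrite leNgt; apply/negP => /Sz.
have supS : has_sup S by split; [exists a|exists x].
have [|d d0 Sd] := step (sup S).
  by move=> y /(sup_adherent_lt supS)[z Sz yz]; exact: Sz.
have : sup S + d <= sup S by apply: (ub_le_sup supS.2) => y; exact: Sd.
lra.
Qed.

Lemma exp2_inj k l : (2 : R) ^ k = 2 ^ l -> k = l.
Proof. by apply: ieexprIz => //; rewrite (eqr_nat R 2 1). Qed.

Lemma locally_affine_derive (f : R -> R) x a d : 0 < d ->
  (forall t, `|t| < d -> f (x + t) = f x + a * t) -> is_derive x 1 f a.
Proof.
move=> d0 fa; pose g (y : R) := f x + a * (y - x).
apply: (@near_eq_is_derive _ _ _ g).
  near=> y; rewrite /g -(fa (y - x)); first by rewrite addrC subrK.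
  rewrite distrC.
  by near: y; exact: nbhsx_ballx.
by apply: is_derive_eq; rewrite add0r mul1r subr0 [LHS]mulr1.
Unshelve. all: by end_near. Qed.

Lemma right_slope_derive1 (f : R -> R) x a d : derivable f x 1 -> 0 < d ->
  (forall t, 0 <= t < d -> f (x + t) = f x + a * t) -> derive1 f x = a.
Proof.
move=> fx d0 fa; rewrite derive1E.
have := cvg_dnbhs_at_right fx => /cvg_unique.
apply => //; apply: cvg_near_cst; near=> t.
have t0 : 0 < t by near: t; exact: nbhs_right_gt.
rewrite /= /GRing.scale /= mulr1 [t + x]addrC fa; last first.
  by rewrite ltW//=; near: t; exact: nbhs_right_lt.
by rewrite addrAC subrr add0r mulrCA mulVf ?mulr1// gt_eqF.
Unshelve. all: by end_near. Qed.

Lemma left_slope_derive1 (f : R -> R) x a d : derivable f x 1 -> 0 < d ->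
  (forall t, 0 <= t < d -> f (x - t) = f x - a * t) -> derive1 f x = a.
Proof.
move=> fx d0 fa; rewrite derive1E.
have := cvg_dnbhs_at_left fx => /cvg_unique.
apply => //; apply: cvg_near_cst; near=> t.
have t0 : t < 0 by near: t; exact: nbhs_left_lt.
rewrite /= /GRing.scale /= mulr1 [t + x]addrC -[X in f (x + X)]opprK fa; last first.
  rewrite oppr_ge0 ltW//= ltrNl -sub0r.
  by near: t; apply: nbhs_left_gt; lra.
by rewrite addrAC subrr add0r !mulrN opprK mulrCA mulVf ?mulr1// lt_eqF.
Unshelve. all: by end_near. Qed.

Lemma local_slopes_derivable (f : R -> R) x k d :
  0 < d -> local_slopes f x k k d -> derivable f x 1.
Proof.
move=> d0 fk; suff /@ex_derive : is_derive x 1 f (2 ^ k) by [].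
apply: (locally_affine_derive d0) => t td.
have [t0|t0] := leP 0 t.
  by rewrite ger0_norm// in td; rewrite (fk _ _).1// t0.
rewrite ltr0_norm// in td; rewrite -[t]opprK (fk _ _).2 ?mulrN//.
by rewrite oppr_ge0 ltW.
Qed.

Lemma local_slopes_near (f : R -> R) x k l d y : local_slopes f x k l d ->
  y != x -> `|y - x| < d -> exists2 e, 0 < e & exists i, local_slopes f y i i e.
Proof.
move=> fx; rewrite neq_lt => /orP[yx|xy].
  rewrite ltr0_norm ?subr_lt0// opprB => yd.
  exists (Num.min (x - y) (d - (x - y))); first by rewrite lt_min; lra.
  exists l => t; rewrite lt_min => /and3P[t0 t1 t2].
  have := (fx (x - y) ltac:(lra)).2; rewrite subKr => ->.
  have := (fx (x - y - t) ltac:(lra)).2; rewrite (_ : x - _ = y + t) => [->|]; last by ring.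
  have := (fx (x - y + t) ltac:(lra)).2; rewrite (_ : x - _ = y - t) => [->|]; last by ring.
  by split; ring.
rewrite gtr0_norm ?subr_gt0// => yd.
exists (Num.min (y - x) (d - (y - x))); first by rewrite lt_min; lra.
exists k => t; rewrite lt_min => /and3P[t0 t1 t2].
have := (fx (y - x) ltac:(lra)).1; rewrite addrC subrK => ->.
have := (fx (y - x + t) ltac:(lra)).1; rewrite (_ : x + _ = y + t) => [->|]; last by ring.
have := (fx (y - x - t) ltac:(lra)).1; rewrite (_ : x + _ = y - t) => [->|]; last by ring.
by split; ring.
Qed.

Lemma finite_isolated (B : set R) x : finite_set B ->
  exists2 d, 0 < d & forall y, B y -> y != x -> d <= `|y - x|.
Proof.
move=> /finite_seqP[s ->]; elim: s => [|z s [d d0 sd]]; first by exists 1.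
have [->|zx] := eqVneq z x.
  exists d => // y /=; rewrite inE => /predU1P[->|/sd//].
  by rewrite eqxx.
exists (Num.min d `|z - x|); first by rewrite lt_min d0 normr_gt0 subr_eq0.
move=> y /=; rewrite inE ge_min => /predU1P[->|ys yx]; first by rewrite lexx orbT.
by rewrite sd.
Qed.

(** An increasing bijection has no jumps: monotonicity bounds [f u] from above, and if [f u] were
    too small, a value in the gap would have no admissible preimage. *)
Lemma affine_right_end (f : homeoR R) u v a b : u < v -> 0 < a ->
  (forall y, u < y < v -> f y = a * y + b) -> f u = a * u + b.
Proof.
move=> uv a0 fab; apply/eqP; rewrite eq_le; apply/andP; split.
  rewrite leNgt; apply/negP => lt.
  pose y := Num.min ((u + v) / 2) (u + (f u - (a * u + b)) / a).
  have e0 : 0 < (f u - (a * u + b)) / a by rewrite divr_gt0// subr_gt0.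
  have uy : u < y by rewrite lt_min; lra.
  have yv : y < v by rewrite gt_min; lra.
  have := homeoR_homo f uy; rewrite (fab y) ?uy//.
  have : y <= u + (f u - (a * u + b)) / a by rewrite ge_min lexx orbT.
  by rewrite -lerBlDl ler_pdivlMr//; lra.
rewrite leNgt; apply/negP => lt.
pose z := f^-1%g ((f u + (a * u + b)) / 2).
have fz : f z = (f u + (a * u + b)) / 2 by rewrite homeoRKV.
have uz : u < z by rewrite -(homeoR_mono f) fz; lra.
pose y := Num.min ((u + v) / 2) z.
have uy : u < y by rewrite lt_min uz andbT; lra.
have yv : y < v by rewrite gt_min; lra.
have yz : y <= z by rewrite ge_min lexx orbT.
have : a * u < a * y by rewrite ltr_pM2l.
move: yz; rewrite -(homeoR_le_mono f) fz fab ?uy//; lra.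
Qed.

Lemma affine_left_end (f : homeoR R) u v a b : u < v -> 0 < a ->
  (forall y, u < y < v -> f y = a * y + b) -> f v = a * v + b.
Proof.
move=> uv a0 fab; suff : mirror 0 f (- v) = a * (- v) + (- b).
  by rewrite mirrorE !sub0r opprK; lra.
apply: (@affine_right_end _ _ (- u)) => // [|y yI]; first by lra.
by rewrite mirrorE !sub0r fab; lra.
Qed.

Section FromThompson.
Variable f : homeoI R.
Hypothesis fF : thompsonF f.

Let fout x : x <= 0 \/ 1 <= x -> f x = x.
Proof.
rewrite !le_eqVlt => -[/predU1P[->|x0]|/predU1P[<-|x1]]; rewrite ?homeoI_0 ?homeoI_1//.
  by rewrite homeoI_out//; apply/negP; lra.
by rewrite homeoI_out//; apply/negP; lra.
Qed.

Let slope u v : u < v -> 0 <= u -> v <= 1 ->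
  (forall y, u < y < v -> ~ breakpoints f y) ->
  exists k b, forall y, u <= y <= v -> f y = 2 ^ k * y + b.
Proof.
move=> uv u0 v1 nB; have [_ aff _ der] := fF.
have [y /=|a [b fab]] := aff u v.
  by rewrite !in_itv/= => /andP[uy yv]; split; [|apply: nB]; apply/andP; split; lra.
have {}fab y : u < y < v -> f y = a * y + b by move=> yI; apply: fab; rewrite in_itv.
pose c := (u + v) / 2.
have fc : is_derive c 1 f a.
  apply: (@locally_affine_derive _ _ _ ((v - u) / 2)); first by lra.
  move=> t; rewrite ltr_norml => td; rewrite !fab; [ring| |]; rewrite /c; apply/andP; split; lra.
have [||k fk] := der c; [by rewrite /c; lra|exact: ex_derive|].
have ak : a = 2 ^ k by rewrite -fk derive1E; exact/esym/derive_val.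
have a0 : 0 < a by rewrite ak exprz_gt0.
exists k, b => y /andP[]; rewrite -ak le_eqVlt => /predU1P[<- _|uy].
  exact: affine_right_end fab.
rewrite le_eqVlt => /predU1P[->|yv]; first exact: affine_left_end fab.
by apply: fab; rewrite uy.
Qed.

Let right_slope x : exists2 d, 0 < d & exists k,
  forall t, 0 <= t < d -> f (x + t) = f x + 2 ^ k * t.
Proof.
have [x0|x0] := ltP x 0.
  exists (- x); first by lra.
  by exists 0 => t td; rewrite !fout ?expr0z ?mul1r//; left; lra.
have [x1|x1] := ltP x 1; last first.
  exists 1 => //; exists 0 => t td.
  by rewrite !fout ?expr0z ?mul1r//; right; lra.
have [Bfin _ _ _] := fF.
have [d d0 Bd] := finite_isolated x Bfin.
pose v := Num.min 1 (x + d).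
have xv : x < v by rewrite lt_min x1; lra.
have v1 : v <= 1 by rewrite ge_min lexx.
have vd : v <= x + d by rewrite ge_min lexx orbT.
have [y /andP[xy yv] /Bd|k [b fk]] := @slope x v xv x0 v1.
  by rewrite gt_eqF// gtr0_norm ?subr_gt0// => /(_ isT); lra.
exists (v - x); first by lra.
by exists k => t td; rewrite !fk; [ring| |]; apply/andP; split; lra.
Qed.

Let left_slope x : exists2 d, 0 < d & exists k,
  forall t, 0 <= t < d -> f (x - t) = f x - 2 ^ k * t.
Proof.
have [x1|x1] := ltP 1 x.
  exists (x - 1); first by lra.
  by exists 0 => t td; rewrite !fout ?expr0z ?mul1r//; right; lra.
have [x0|x0] := ltP 0 x; last first.
  exists 1 => //; exists 0 => t td.
  by rewrite !fout ?expr0z ?mul1r//; left; lra.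
have [Bfin _ _ _] := fF.
have [d d0 Bd] := finite_isolated x Bfin.
pose u := Num.max 0 (x - d).
have ux : u < x by rewrite gt_max x0; lra.
have u0 : 0 <= u by rewrite le_max lexx.
have ud : x - d <= u by rewrite le_max lexx orbT.
have [y /andP[uy yx] /Bd|k [b fk]] := @slope u x ux u0 x1.
  by rewrite lt_eqF// ltr0_norm ?subr_lt0// => /(_ isT); lra.
exists (x - u); first by lra.
by exists k => t td; rewrite !fk; [ring| |]; apply/andP; split; lra.
Qed.

Let nondyadic_derivable x : ~ dyadic x -> derivable f x 1.
Proof.
move=> ndx; have [_ _ Bdy _] := fF.
have d01 : dyadic (0 : R) /\ dyadic (1 : R).
  by split; [exact: (dyadic_int _ 0)|exact: (dyadic_int _ 1)].
have [xI|] := boolP (0 < x < 1).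
  by apply: contrapT => nd; apply/ndx/Bdy.
have x0 : x != 0 by apply/eqP => x0; apply: ndx; rewrite x0; case: d01.
have x1 : x != 1 by apply/eqP => x1; apply: ndx; rewrite x1; case: d01.
rewrite negb_and -!leNgt => xI.
have {}xI : x < 0 \/ 1 < x.
  by move: xI; rewrite le_eqVlt (negbTE x0) [1 <= x]le_eqVlt eq_sym (negbTE x1) => /orP.
case: xI => xI.
  suff /@ex_derive : is_derive x 1 f 1 by [].
  apply: (@locally_affine_derive _ _ _ (- x)); first by lra.
  by move=> t; rewrite ltr_norml => td; rewrite !fout ?mul1r//; left; lra.
suff /@ex_derive : is_derive x 1 f 1 by [].
apply: (@locally_affine_derive _ _ _ (x - 1)); first by lra.
by move=> t; rewrite ltr_norml => td; rewrite !fout ?mul1r//; right; lra.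
Qed.

Let slopes x : exists d k l,
  [/\ 0 < d, dyadic x \/ k = l & local_slopes f x k l d].
Proof.
have [d d0 [k fk]] := right_slope x; have [e e0 [l fl]] := left_slope x.
exists (Num.min d e), k, l; split; first by rewrite lt_min d0.
  have [dx|/nondyadic_derivable fx] := pselect (dyadic x); [by left|right].
  by apply: exp2_inj; rewrite -(right_slope_derive1 fx d0 fk) (left_slope_derive1 fx e0 fl).
by move=> t; rewrite lt_min => /and3P[t0 td te]; split; [apply: fk|apply: fl]; rewrite t0.
Qed.

(** The property spreads to the right from the negative half-line, where f is the identity. Given a
    dyadic y with [f y] dyadic, f x = f y + 2^l (x - y) is dyadic exactly when x is. *)
Let dyadic_pres x : dyadic x <-> dyadic (f x).
Proof.
move: x; apply: (@real_induction _ 0) => [x x0|x IH].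
  by rewrite fout//; left; exact: ltW.
have [d [k [l [d0 kl fx]]]] := slopes x.
have [y dy /andP[y1 y2]] := @dyadic_dense R (x - d) x ltac:(lra).
have dfy : dyadic (f y) by exact: (IH y y2).1.
have fxy : f x = f y + 2 ^ l * (x - y).
  by have := (fx (x - y) ltac:(lra)).2; rewrite subKr => ->; ring.
have Px : dyadic x <-> dyadic (f x).
  rewrite fxy; apply: iff_trans (iff_sym (dyadicDE _ dfy)).
  apply: iff_trans (iff_sym (dyadicZE l _)).
  by rewrite addrC; apply: iff_sym; apply: dyadicDE; exact: dyadicN.
exists d => // z zd; have [zx|xz] := ltP z x; first exact: IH.
have fz : f z = f x + 2 ^ k * (z - x).
  by have := (fx (z - x) ltac:(lra)).1; rewrite addrC subrK.
(* At a dyadic x the slopes may differ, but x itself serves as base point. Otherwise the slopes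
   agree and the earlier base point y still works beyond x. *)
have [dx|ndx] := pselect (dyadic x).
  rewrite fz; apply: iff_trans (iff_sym (dyadicDE _ (Px.1 dx))).
  apply: iff_trans (iff_sym (dyadicZE k _)).
  by rewrite addrC; apply: iff_sym; apply: dyadicDE; exact: dyadicN.
have {}kl : k = l by case: kl.
have -> : f z = f y + 2 ^ l * (z - y) by rewrite fz fxy kl; ring.
apply: iff_trans (iff_sym (dyadicDE _ dfy)).
apply: iff_trans (iff_sym (dyadicZE l _)).
by rewrite addrC; apply: iff_sym; apply: dyadicDE; exact: dyadicN.
Qed.

Lemma thompsonF_PL : is_PL f. Proof. by split. Qed.

End FromThompson.

Lemma PL_thompsonF (f : homeoI R) : is_PL f -> thompsonF f.
Proof.
move=> [_ fl].
have slope_der x k : derivable f x 1 -> forall l d, 0 < d -> local_slopes f x k l d ->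
    derive1 f x = 2 ^ k /\ k = l.
  move=> fx l d d0 h.
  have h1 := right_slope_derive1 fx d0 (fun t td => (h t td).1).
  have h2 := left_slope_derive1 fx d0 (fun t td => (h t td).2).
  by split=> //; apply: exp2_inj; rewrite -h1 -h2.
split.
- have : forall x, finite_set (breakpoints f `&` [set y | y <= x]).
    apply: (@real_induction _ 0) => [x x0|x IH].
      rewrite (_ : _ `&` _ = set0)// -subset0 => y [[/andP[y0 _] _] /= yx]; lra.
    have [d [k [l [d0 _ fx]]]] := fl x.
    exists d => // y yd.
    apply: (@sub_finite_set _ _ ((breakpoints f `&` [set y | y <= x - d / 2]) `|` [set x])).
      move=> z [zB /= zy]; have [zd|zd] := leP z (x - d / 2); [by left|right].
      apply: contrapT => /eqP zx; case: zB => _; apply.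
      have [||e e0 [i fi]] := @local_slopes_near _ _ _ _ _ z fx => //.
        by rewrite ltr_norml; lra.
      exact: local_slopes_derivable fi.
    by rewrite finite_setU; split=> //; apply: IH; lra.
  move=> /(_ 1); apply: sub_finite_set => x xB; split => //.
  by case: xB => /andP[_ x1] _; exact: ltW.
- move=> u v uvB.
  have der x : u < x < v -> derivable f x 1.
    move=> xI; have [] : (`]0, 1[ `\` breakpoints f) x by apply: uvB; rewrite /= in_itv.
    by rewrite /= in_itv/= => x01 nB; apply: contrapT => nd; exact: nB.
  have [vu|uv] := leP v u.
    by exists 0, 0 => x; rewrite in_itv/= => /andP[? ?]; lra.
  (* Continuation of the affine formula at c to the right: the absence of breakpoints forces the
     slope found on the left of each new point to persist on its right. *)
  have glob c kc d : u < c < v -> 0 < d -> local_slopes f c kc kc d ->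
      forall x, c <= x < v -> f x = f c + 2 ^ kc * (x - c).
    move=> /andP[uc cv] d0 fc.
    apply: (@real_induction _ c) => [x xc /andP[cx _]|x IH]; first by lra.
    have [xc|cx] := ltP x c.
      by exists (c - x); [lra|move=> y yc /andP[cy _]; lra].
    have [xv|vx] := ltP x v; last first.
      by exists 1 => // y _ /andP[cy yv]; apply: IH; [lra|apply/andP].
    move: cx; rewrite le_eqVlt => /predU1P[<-|cx].
      exists d => // y yd /andP[cy _].
      by have := (fc (y - c) ltac:(lra)).1; rewrite addrC subrK.
    have [e [k [l [e0 _ fx]]]] := fl x.
    have [_ kl] := slope_der _ _ (der x ltac:(lra)) _ _ e0 fx; rewrite -{}kl in fx.
    pose w := Num.min (x - c) e / 2.
    have w0 : 0 < w by rewrite divr_gt0// lt_min e0 andbT subr_gt0.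
    have wc : w < x - c.
      by rewrite ltr_pdivrMr// gt_min; apply/orP; left; lra.
    have we : w < e by rewrite ltr_pdivrMr// gt_min; apply/orP; right; lra.
    have h1 := (fx w ltac:(lra)).2; rewrite IH in h1; [|lra|lra].
    have h2 := (fx (w / 2) ltac:(lra)).2; rewrite IH in h2; [|lra|lra].
    have kk : (2 : R) ^ kc = 2 ^ k by apply: (mulIf (lt0r_neq0 w0)); lra.
    exists e => // y ye /andP[cy yv]; have [yx|xy] := ltP y x.
      by apply: IH => //; apply/andP.
    have := (fx (y - x) ltac:(lra)).1; rewrite [x + _]addrC subrK => ->.
    by move: h1; rewrite kk; lra.
  have slope_at x : u < x < v -> exists2 d, 0 < d & exists k, local_slopes f x k k d.
    move=> xI; have [e [k [l [e0 _ fx]]]] := fl x.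
    have [_ kl] := slope_der _ _ (der x xI) _ _ e0 fx.
    by exists e => //; exists k; rewrite {2}kl.
  pose c := (u + v) / 2; have cI : u < c < v by rewrite /c; lra.
  have [d d0 [k fc]] := slope_at c cI.
  exists (2 ^ k), (f c - 2 ^ k * c) => x; rewrite in_itv/= => /andP[ux xv].
  have [cx|xc] := leP c x.
    by rewrite (glob c k d) ?cx//; ring.
  have [e e0 [i fx]] := slope_at x ltac:(lra).
  (* No induction to the left is needed: the formula continued from x reaches both c and c', and
     comparison with the formula at c forces equal slopes. *)
  pose c' := (c + v) / 2.
  have h1 := glob c k d cI d0 fc c' ltac:(rewrite /c'; lra).
  have h2 := glob x i e ltac:(lra) e0 fx c' ltac:(rewrite /c'; lra).
  have h3 := glob x i e ltac:(lra) e0 fx c ltac:(lra).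
  have ik : (2 : R) ^ i = 2 ^ k.
    by apply: (mulIf (_ : c' - c != 0)); [rewrite /c'; lra|lra].
  by move: h3; rewrite ik; lra.
- move=> x [/andP[x0 x1] nx]; have [d [k [l [d0 [//|kl] fx]]]] := fl x.
  by case: nx; rewrite -kl in fx; exact: local_slopes_derivable fx.
- move=> x _ fx; have [d [k [l [d0 _ h]]]] := fl x; exists k.
  by have [] := slope_der _ _ fx _ _ d0 h.
Qed.

End ThompsonPL.

(** * Normal form modulo the derived group in a two-generated group *)

Section TwoGenerated.
Variable gT : groupType.
Implicit Types (x y : gT) (a b : int).

Definition zpow x a : gT :=
  match a with Posz n => x ^+ n | Negz n => x ^- n.+1 end%g.

Lemma zpowS x a : zpow x (a + 1) = (zpow x a * x)%g.
Proof.
case: a => [n|[|n]]; first by rewrite -PoszD addn1 /= expgSr.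
  by rewrite /= mulVg.
rewrite (_ : Negz n.+1 + 1 = Negz n); last by rewrite !NegzE; lia.
by rewrite /= [in RHS]expgS invgM mulgVK.
Qed.

Lemma zpowNn x (n : nat) : zpow x (- n%:Z) = (x ^- n)%g.
Proof. by case: n => [|n]; rewrite ?oppr0 ?invg1// -NegzE. Qed.

Lemma zpowB x a b : zpow x (a - b) = (zpow x a / zpow x b)%g.
Proof.
elim/int_rect: b => [|n IH|n IH]; first by rewrite subr0 invg1 mulg1.
  rewrite [zpow x n.+1]expgS invgM mulgA -IH.
  rewrite (_ : a - n%:Z = (a - n.+1%:Z) + 1); last by lia.
  by rewrite zpowS mulgK.
rewrite zpowNn invgK expgSr mulgA.
rewrite zpowNn invgK in IH; rewrite -IH -zpowS; congr zpow; lia.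
Qed.

Lemma zpow0 x : zpow x 0 = 1%g. Proof. by []. Qed.

Lemma zpowV x a : zpow x (- a) = (zpow x a)^-1%g.
Proof. by rewrite -sub0r zpowB zpow0 mul1g. Qed.

Lemma generated2_mod_derived x y f : generated [set x; y] f ->
  exists a b, exists2 d, derived (generated [set x; y]) d &
    f = (zpow x a * zpow y b * d)%g.
Proof.
set G := generated [set x; y].
have GG : subgroup G by exact: generated_subgroup.
have DD : subgroup (derived G) by exact: derived_subgroup.
have Gz z a : G z -> G (zpow z a).
  move=> Gz; have Gn n : G (z ^+ n)%g.
    by elim: n => [|n IH]; [exact: (subgroup1 GG)|rewrite expgS; exact: (subgroupM GG)].
  case: a => n /=; first exact: Gn.
  exact: (subgroupV GG (Gn _)).
have Gx : G x by apply: sub_generated; left.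
have Gy : G y by apply: sub_generated; right.
have Dconj d h : derived G d -> G h -> derived G (d ^ h)%g.
  by move=> Dd Gh; apply: derived_conj Dd => z Gz'; exact: (subgroupJ GG).
move: f; apply: generated_min; last first.
  move=> f [->|->]; [exists 1, 0|exists 0, 1]; exists 1%g; rewrite /= ?mulg1 ?mul1g//.
    exact: subgroup1.
  exact: subgroup1.
apply: mk_subgroup => [|f g /= [a [b [d Dd ->]]] [a' [b' [d' Dd' ->]]]].
  by exists 0, 0, 1%g; [exact: subgroup1|rewrite !mulg1].
set X := zpow x; set Y := zpow y.
exists (a - a'), (b - b').
(* The commutator is the cost of moving X(-a') to the left of Y(b - b'); the derived factors are
   collected as a conjugate of d / d'. *)
exists ([~ Y (b - b'), X (- a')] * (d / d') ^ (X a' * Y b')^-1)%g.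
  apply: (subgroupM DD); first by apply: derivedR; exact: Gz.
  apply: Dconj; first exact: (subgroupMV DD).
  by apply: (subgroupV GG); apply: (subgroupM GG); exact: Gz.
transitivity (X a * (Y (b - b') * X (- a')) * (d / d') ^ (X a' * Y b')^-1)%g.
  rewrite conjgE invgK /X /Y zpowB zpowV !invgM !mulgA.
  by rewrite mulgVK mulgVK.
by rewrite (commgC (Y _)) /X zpowB zpowV !mulgA.
Qed.

End TwoGenerated.

(** * Slopes at a fixed point as homomorphisms to the integers *)

Section Germs.
Variable R : realType.
Implicit Types (f g : R -> R) (s p : R) (k l : int).

(* The germ at p is taken on the right for s = 1 and on the left for s = -1. *)
Definition germ s p f k : Prop :=
  exists2 d, 0 < d & forall t, 0 <= t < d -> f (p + s * t) = p + s * (2 ^ k * t).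

Lemma germ_inj s p f k l : s != 0 -> germ s p f k -> germ s p f l -> k = l.
Proof.
move=> s0 [d d0 fk] [e e0 fl]; apply: (@exp2_inj R).
pose t := Num.min d e / 2.
have m0 : 0 < Num.min d e by rewrite lt_min d0.
have t0 : 0 < t by rewrite divr_gt0.
have tm : t < Num.min d e by rewrite /t; lra.
move: tm; rewrite lt_min => /andP[td te].
have := fk t; rewrite fl ?(ltW t0)// => /(_ td)/addrI/(mulfI s0).
by move=> /(mulIf (lt0r_neq0 t0)) ->.
Qed.

Lemma germ_comp s p f g k l :
  germ s p f k -> germ s p g l -> germ s p (g \o f) (k + l).
Proof.
move=> [d d0 fk] [e e0 gl].
have k0 : (0 : R) < 2 ^ k by rewrite exprz_gt0.
exists (Num.min d (e / 2 ^ k)); first by rewrite lt_min d0 divr_gt0.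
move=> t; rewrite lt_min ltr_pdivlMr// => /and3P[t0 td te] /=.
rewrite fk ?t0// gl; last by rewrite mulr_ge0 ?(ltW k0)//= mulrC.
by rewrite expfzDr// mulrA [2 ^ l * _]mulrC.
Qed.

Lemma germ_can s p f g k : cancel f g -> germ s p f k -> germ s p g (- k).
Proof.
move=> fg [d d0 fk]; have k0 : (0 : R) < 2 ^ k by rewrite exprz_gt0.
exists (d * 2 ^ k); first by rewrite mulr_gt0.
move=> t /andP[t0 td].
have e : 2 ^ k * (2 ^ (- k) * t) = t by rewrite mulrA -expfzDr// subrr expr0z mul1r.
apply: (canLR fg); rewrite fk ?e//.
by rewrite -invr_expz mulr_ge0 ?invr_ge0 ?(ltW k0)//= mulrC ltr_pdivrMr.
Qed.

Lemma germ_id s p f : (exists2 d, 0 < d & forall t, 0 <= t < d -> f (p + s * t) = p + s * t) ->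
  germ s p f 0.
Proof. by move=> [d d0 fp]; exists d => // t /fp ->; rewrite expr0z mul1r. Qed.

Lemma PL_germ s p f : s = 1 \/ s = -1 -> is_PL f -> f p = p -> exists k, germ s p f k.
Proof.
move=> s1 [_ /(_ p)[d [k [l [d0 _ fp]]]]] fpp.
case: s1 => ->; [exists k|exists l]; exists d => // t /fp[h1 h2].
  by rewrite !mul1r h1 fpp.
by rewrite !mulN1r h2 fpp.
Qed.

Lemma germ_zpow s p (x : homeoI R) k a : germ s p x k -> germ s p (zpow x a) (a * k).
Proof.
move=> xk; have xn n : germ s p (x ^+ n)%g (n%:Z * k).
  elim: n => [|n IH]; first by rewrite mul0r; apply: germ_id; exists 1.
  by rewrite -addn1 PoszD mulrDl mul1r addn1 expgSr; exact: germ_comp IH xk.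
case: a => [n|n]; first exact: xn.
by rewrite NegzE mulNr; exact: germ_can (homeoIVK _) (xn _).
Qed.

Lemma germ0_subgroup s p : subgroup [set f : homeoI R | germ s p f 0].
Proof.
apply: mk_subgroup => [|f g /= f0 g0]; first by apply: germ_id; exists 1.
rewrite -(addr0 0) -{2}oppr0.
exact: germ_comp f0 (germ_can (homeoIVK g) g0).
Qed.

(** Slope exponents at a common fixed point add under composition, so they cancel in a
    commutator. *)
Lemma derived_germ s p (G : set (homeoI R)) :
  (forall f : homeoI R, G f -> exists k, germ s p f k) ->
  derived G `<=` [set f : homeoI R | germ s p f 0].
Proof.
move=> Gk; apply: derived_min; first exact: germ0_subgroup.
move=> f g /Gk[k fk] /Gk[l gl] /=.
rewrite (_ : 0 = - k + (- l + (k + l))); last by lia.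
have fV := germ_can (homeoIVK f) fk; have gV := germ_can (homeoIVK g) gl.
exact: germ_comp fV (germ_comp gV (germ_comp fk gl)).
Qed.

End Germs.

(** * Passage between homeomorphisms of the line and of the unit interval *)

Section HomeoI.
Variable R : realType.

(** The default value is the identity, so the result is meaningful only for f supported in
    [0, 1]. *)
Definition toI (f : homeoR R) : homeoI R := insubd (1%g : homeoI R) f.

Lemma toIE (f : homeoR R) : supported 0 1 f -> toI f = f :> homeoR R.
Proof. by move=> fs; apply: insubdK; exact/asboolP. Qed.

Lemma supp_sub (r s : R) (f : R -> R) :
  supp f `<=` `[r, s] <-> forall x, ~~ (r <= x <= s) -> f x = x.
Proof.
split=> [fs x xI|fs x fx]; last first.
  by rewrite /= in_itv/=; apply: contrapT => /negP xI; exact: fx (fs x xI).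
by apply: contrapT => /fs; rewrite /= in_itv/= (negbTE xI).
Qed.

Lemma homeoI_supported (f : homeoI R) : supported 0 1 f.
Proof. by move=> x; exact: homeoI_out. Qed.

Lemma thompsonF_on_PLc (r s : R) (f : homeoI R) : 0 < r -> r <= s -> s < 1 ->
  thompsonF_on r s f -> PLc 0 1 (f : homeoR R).
Proof.
move=> r0 rs s1 [/thompsonF_PL fF /supp_sub fs]; split => //.
by exists r, s.
Qed.

Lemma PLc_thompsonF_on (r s : R) (f : homeoR R) : 0 <= r -> s <= 1 ->
  is_PL f -> supported r s f -> thompsonF_on r s (toI f).
Proof.
move=> r0 s1 fP fs; have f01 := supported_sub r0 s1 fs.
by split; [apply: PL_thompsonF|apply/supp_sub]; rewrite toIE.
Qed.

End HomeoI.

(** * Perfectness from two generators of the group on [1/16, 15/16] *)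

Section Perfect.
Variables (R : realType) (c : homeoR R) (x y : homeoI R).
Hypotheses (cPL : is_PL c) (csupp : supported 0 (1 / 4) c).
Hypothesis c2 : forall t, 0 <= t < 1 / 16 -> c t = 2 * t.
Hypothesis genF : generated [set x; y] = thompsonF_on (1 / 16) (15 / 16).

Let dyadic_frac (m : int) k : dyadic (m%:~R / 2 ^+ k : R).
Proof. by exists m, k. Qed.

(** An element with trivial germs at both end points is x^a y^b d with (a, b) killed by the slope
    matrix of x and y. That matrix is invertible over the integers, since two elements realise the
    exponents (1, 0) and (0, 1); hence the element equals d. *)
Lemma middle_perfect : PLc (1 / 16) (15 / 16) `<=` derived (PLc 0 1 : set (homeoR R)).
Proof.
pose G := generated [set x; y].
have d16 : dyadic (1 / 16 : R).
  by have := dyadic_frac 1 4; rewrite -natrX.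
(* Translated to start at 1/16, [c] has slope 2 there and is trivial near 15/16; its mirror image
   has the opposite behaviour. *)
pose u := (c ^ affine 0 (1 / 16))%g.
have uE t : u t = c (t - 1 / 16) + 1 / 16.
  by rewrite conjg_affine oppr0 !expr0z !mul1r.
have uP : is_PL u by apply: (subgroupJ (PL_subgroup R)) => //; exact: affine_PL.
have us : supported (1 / 16) (5 / 16) u.
  have := supported_conj (g := affine 0 (1 / 16)) csupp.
  by apply: supported_sub; rewrite affineE expr0z; lra.
have vP : is_PL (mirror 1 u) by apply: mirror_PL => //; exact: (dyadic_int _ 1).
have vs : supported (11 / 16) (15 / 16) (mirror 1 u).
  by apply: supported_sub (supported_mirror (c := 1) us); lra.
have Gu : G (toI u).
  by rewrite /G genF; apply: PLc_thompsonF_on uP _; [lra|lra|apply: supported_sub us; lra].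
have Gv : G (toI (mirror 1 u)).
  by rewrite /G genF; apply: PLc_thompsonF_on vP _; [lra|lra|apply: supported_sub vs; lra].
have uI : toI u = u :> homeoR R by apply: toIE; apply: supported_sub us; lra.
have vI : toI (mirror 1 u) = mirror 1 u :> homeoR R.
  by apply: toIE; apply: supported_sub vs; lra.
have Gfix f : G f -> [/\ is_PL f, f (1 / 16) = 1 / 16 & f (15 / 16) = 15 / 16].
  rewrite /G genF => -[/thompsonF_PL fP /supp_sub fs].
  have [||] := @supported_end R (1 / 16) (15 / 16) f; [lra|exact: fs|].
  by split.
have Gl f : G f -> exists k, germ 1 (1 / 16) f k.
  by move=> /Gfix[fP f1 _]; apply: PL_germ => //; left.
have Gr f : G f -> exists k, germ (-1) (15 / 16) f k.
  by move=> /Gfix[fP _ f1]; apply: PL_germ => //; right.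
have Gx : G x by apply: sub_generated; left.
have Gy : G y by apply: sub_generated; right.
have [[k1 xl] [k2 yl]] := (Gl _ Gx, Gl _ Gy).
have [[l1 xr] [l2 yr]] := (Gr _ Gx, Gr _ Gy).
have decomp f : G f -> exists a b, exists2 d, derived G d &
    [/\ f = (zpow x a * zpow y b * d)%g, germ 1 (1 / 16) f (a * k1 + b * k2)
      & germ (-1) (15 / 16) f (a * l1 + b * l2)].
  move=> /generated2_mod_derived[a [b [d Dd ->]]]; exists a, b, d => //; split=> //.
    rewrite -[_ + _]addr0.
    exact: germ_comp (germ_comp (germ_zpow _ xl) (germ_zpow _ yl)) (derived_germ Gl Dd).
  rewrite -[_ + _]addr0.
  exact: germ_comp (germ_comp (germ_zpow _ xr) (germ_zpow _ yr)) (derived_germ Gr Dd).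
have s1 : (1 : R) != 0 by exact: oner_neq0.
have sN1 : (-1 : R) != 0 by rewrite oppr_eq0.
have [a1 [b1 [_ _ [_ ul ur]]]] := decomp _ Gu.
have [a2 [b2 [_ _ [_ vl vr]]]] := decomp _ Gv.
have e1 : a1 * k1 + b1 * k2 = 1.
  apply: germ_inj s1 ul _; exists (1 / 16); first by lra.
  by move=> t td; rewrite uI uE mul1r addrAC subrr add0r c2 ?expr1z//; lra.
have e2 : a1 * l1 + b1 * l2 = 0.
  apply: germ_inj sN1 ur _; apply: germ_id; exists (1 / 16); first by lra.
  by move=> t td; rewrite uI us//; apply/negP; lra.
have e3 : a2 * k1 + b2 * k2 = 0.
  apply: germ_inj s1 vl _; apply: germ_id; exists (1 / 16); first by lra.
  by move=> t td; rewrite vI vs//; apply/negP; lra.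
have e4 : a2 * l1 + b2 * l2 = 1.
  apply: germ_inj sN1 vr _; exists (1 / 16); first by lra.
  move=> t td; rewrite vI mirrorE uE (_ : 1 - _ - _ = t) ?c2// ?expr1z; lra.
move=> f [fP [p [q [p0 pq q1 fs]]]].
have f16 : supported (1 / 16) (15 / 16) f by apply: supported_sub fs; exact: ltW.
have fI : toI f = f :> homeoR R by apply: toIE; apply: supported_sub f16; lra.
have [|a [b [d Dd [fE fl fr]]]] := decomp (toI f).
  by rewrite /G genF; apply: PLc_thompsonF_on fP f16; lra.
have e5 : a * k1 + b * k2 = 0.
  apply: germ_inj s1 fl _; apply: germ_id; exists (p - 1 / 16); first by lra.
  by move=> t td; rewrite fI fs//; apply/negP; lra.
have e6 : a * l1 + b * l2 = 0.
  apply: germ_inj sN1 fr _; apply: germ_id; exists (15 / 16 - q); first by lra.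
  by move=> t td; rewrite fI fs//; apply/negP; lra.
(* The slope matrix of x and y has an integral inverse, so a = b = 0. *)
have det : (a1 * b2 - a2 * b1) * (k1 * l2 - k2 * l1) = 1.
  have -> : (a1 * b2 - a2 * b1) * (k1 * l2 - k2 * l1) =
    (a1 * k1 + b1 * k2) * (a2 * l1 + b2 * l2) - (a2 * k1 + b2 * k2) * (a1 * l1 + b1 * l2) by ring.
  by rewrite e1 e2 e3 e4.
have a0 : a = 0.
  rewrite -[a]mulr1 -det mulrCA.
  rewrite (_ : a * (k1 * l2 - k2 * l1) = (a * k1 + b * k2) * l2 - (a * l1 + b * l2) * k2); last by ring.
  by rewrite e5 e6 !mul0r subr0 mulr0.
have b0 : b = 0.
  rewrite -[b]mulr1 -det mulrCA.
  rewrite (_ : b * (k1 * l2 - k2 * l1) = (a * l1 + b * l2) * k1 - (a * k1 + b * k2) * l1); last by ring.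
  by rewrite e5 e6 !mul0r subr0 mulr0.
have {}fE : toI f = d by rewrite fE a0 b0 !zpow0 !mul1g.
rewrite -fI fE; move: d Dd {fE}.
have DD := derived_subgroup (PLc 0 1 : set (homeoR R)).
apply: derived_min.
  apply: mk_subgroup => [|g h /= Dg Dh]; first exact: (subgroup1 DD).
  exact: (subgroupMV DD Dg Dh).
(* The margin of 1/16 on both sides turns commutators in G into commutators of elements compactly
   supported in (0, 1). *)
have GP g : G g -> PLc 0 1 (g : homeoR R).
  rewrite /G genF; apply: thompsonF_on_PLc; lra.
by move=> g h /GP Pg /GP Ph; exact: (derivedR Pg Ph).
Qed.

End Perfect.

(* The cell (n, false) is [n, n + 1/2] and (n, true) is [n - 1/2, n]; in both
   cases iso parametrises it by the distance to its integer endpoint n. *)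
Notation cell := (int * bool)%type.

(** * Half-unit cells, unit tiles and the local actions on sets of cells *)

Section Cells.
Variables (R : realType) (rho : int -> letter).
Hypothesis rhoP : labelling rho.
Implicit Types (s o : bool) (t x : R) (m n i : int) (f g h : homeoR R).

Implicit Types (j : cell) (A B : pred cell).

Definition iso j t : R := if j.2 then j.1%:~R - t else j.1%:~R + t.

Definition positive (l : letter) : bool := if l is (La | Lb) then true else false.

(* The labelling, up to exponent sign, as read from the cell j in the direction
   away from its integer endpoint. *)
Definition view j i : bool :=
  if j.2 then ~~ positive (rho (2 * j.1 - i)) else positive (rho (2 * j.1 + i)).

(* The tiles of zeta (s = true) and chi (s = false) are the unit intervals with
   centers in ctr s + Z; the label of such a tile is the one at its center, which
   has index idx s in the views of both cells of the tile. *)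
Definition ctr s : R := if s then 1 / 2 else 0.
Definition idx s : int := if s then 1 else 0.

(* The cell sharing with j its half-integer (s = true) or integer endpoint. *)
Definition nbr s j : cell :=
  if s then (if j.2 then (j.1 - 1, false) else (j.1 + 1, true)) else (j.1, ~~ j.2).

(** The translation is by m in the reading direction of the cell, hence by -m for a cell read
    leftwards. *)
Definition shift_cell m j : cell := (if j.2 then j.1 - m else j.1 + m, j.2).

Lemma positive_inv l : positive (letter_inv l) = ~~ positive l.
Proof. by case: l. Qed.

Lemma nbrK s : involutive (nbr s).
Proof. by case: s => -[n []]; rewrite /nbr/= ?addrK ?subrK. Qed.

Lemma iso_nbr s j t : iso (nbr s j) t = iso j (2 * ctr s - t).
Proof. by case: s j => -[n []]; rewrite /iso /nbr /ctr/= ?intrD ?intrB ?mulr1z; lra. Qed.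

Lemma view_nbr s j i : view (nbr s j) i = ~~ view j (2 * idx s - i).
Proof.
case: s j => -[n []]; rewrite /view /nbr /idx/= ?negbK;
  do ?[congr (~~ _)]; congr (positive (rho _)); lia.
Qed.

Lemma iso_shift m j t : iso (shift_cell m j) t = iso j (m%:~R + t).
Proof. by case: j => n []; rewrite /iso /shift_cell/= ?intrD ?intrB; lra. Qed.

Lemma view_shift m j i : view (shift_cell m j) i = view j (2 * m + i).
Proof.
case: j => n []; rewrite /view /shift_cell/=; do ?[congr (~~ _)];
  congr (positive (rho _)); lia.
Qed.

Lemma iso_inj j : injective (iso j).
Proof. by case: j => n [] t u; rewrite /iso/= => /addrI // /oppr_inj. Qed.

Definition centered s t : bool := ctr s - 1 / 2 <= t <= ctr s + 1 / 2.

Lemma centered_mirror s t : centered s (2 * ctr s - t) = centered s t.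
Proof. by rewrite /centered; apply/idP/idP; lra. Qed.

Lemma centered_decomp s x : exists m, centered s (x - m%:~R).
Proof.
exists (Num.floor (x - ctr s + 1 / 2)).
have := floor_itv (x - ctr s + 1 / 2); rewrite intrD mulr1z /centered => /andP[? ?].
by apply/andP; split; lra.
Qed.

(** The two cells of a tile read its label with opposite signs. In the coordinates of the one that
    reads it as positive, the tile carries the given map unreflected, which spares a case
    distinction in later proofs. *)
Lemma positive_cellP s x : exists j t,
  [/\ x = iso j t, centered s t & view j (idx s)].
Proof.
have [m mx] := centered_decomp s x.
have xE : x = iso (m, false) (x - m%:~R) by rewrite /iso/= addrC subrK.
have [v|v] := boolP (view (m, false) (idx s)).
  by exists (m, false), (x - m%:~R).
exists (nbr s (m, false)), (2 * ctr s - (x - m%:~R)); split.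
- by rewrite iso_nbr subKr.
- by rewrite centered_mirror.
- by rewrite view_nbr (_ : 2 * idx s - idx s = idx s)//; lia.
Qed.

Lemma cellP x : exists j t, x = iso j t /\ 0 <= t <= 1 / 2.
Proof.
have [m] := centered_decomp false x; rewrite /centered /ctr => mx.
have [t0|t0] := leP 0 (x - m%:~R).
  by exists (m, false), (x - m%:~R); rewrite /iso/=; split; lra.
by exists (m, true), (m%:~R - x); rewrite /iso/=; split; lra.
Qed.

Lemma half_centered s t : 0 <= t <= 1 / 2 -> centered s t.
Proof. by case: s; rewrite /centered /ctr; lra. Qed.

Definition tileM s (f : homeoI R) : homeoR R := if s then zeta rho f else chi rho f.

Definition recenter s (f : homeoI R) t : R := f (t - (ctr s - 1 / 2)) + (ctr s - 1 / 2).

Lemma recenter_centered s (f : homeoI R) t : centered s t -> centered s (recenter s f t).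
Proof.
move=> ts; rewrite /recenter; have := @supported_itv _ 0 1 f (t - (ctr s - 1 / 2)) ler01 (homeoI_supported f).
by move: ts; rewrite /centered => ts e; have : 0 <= f (t - (ctr s - 1 / 2)) <= 1; [rewrite e; lra|lra].
Qed.

Lemma tileM_iso s (f : homeoI R) j t : centered s t ->
  tileM s f (iso j t) =
  iso j (if view j (idx s) then recenter s f t
         else 2 * ctr s - recenter s f (2 * ctr s - t)).
Proof.
have bpos n : (rho (2 * n + 1) == Lb) = positive (rho (2 * n + 1)).
  by have [_] := rhoP n; rewrite !inE => /orP[] /eqP ->.
have apos n : (rho (2 * n) == La) = positive (rho (2 * n)).
  by have [+ _] := rhoP n; rewrite !inE => /orP[] /eqP ->.
rewrite /centered /tileM /zeta /chi; case: s; case: j => n [];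
  rewrite /ctr /idx /iso /view /recenter; cbn [fst snd] => tI.
- rewrite (@tileE _ _ _ (n - 1)); last by rewrite intrB mulr1z; lra.
  rewrite bpos (_ : 2 * (n - 1) + 1 = 2 * n - 1); last by lia.
  rewrite intrB mulr1z.
  case: (positive _) => /=; rewrite ?iota_conjE.
    rewrite (_ : n%:~R - t - _ = 1 - t); last by lra.
    by rewrite (_ : 2 * (1 / 2) - t - _ = 1 - t); lra.
  rewrite (_ : 1 - (n%:~R - t - _) = t); last by lra.
  by rewrite (_ : t - (1 / 2 - 1 / 2) = t); lra.
- rewrite (@tileE _ _ _ n); last by lra.
  rewrite bpos (_ : n%:~R + t - _ = t); last by lra.
  case: (positive _) => /=; rewrite ?iota_conjE.
    by rewrite (_ : t - (1 / 2 - 1 / 2) = t); lra.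
  by rewrite (_ : 2 * (1 / 2) - t - _ = 1 - t); lra.
- rewrite (@tileE _ _ _ n); last by lra.
  rewrite apos subr0; case: (positive _) => /=; rewrite ?iota_conjE.
    rewrite (_ : n%:~R - t - _ = 2^-1 - t); last by lra.
    by rewrite (_ : 2 * 0 - t - _ = 2^-1 - t); lra.
  rewrite (_ : 1 - (n%:~R - t - _) = t + 2^-1); last by lra.
  by rewrite (_ : t - (0 - 1 / 2) = t + 2^-1); lra.
- rewrite (@tileE _ _ _ n); last by lra.
  rewrite apos addr0 (_ : n%:~R + t - _ = t + 2^-1); last by lra.
  case: (positive _) => /=; rewrite ?iota_conjE.
    by rewrite (_ : t - (0 - 1 / 2) = t + 2^-1); lra.
  by rewrite (_ : 2 * 0 - t - (0 - 1 / 2) = 1 - (t + 2^-1)); lra.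
Qed.

Lemma tileM_mul s (f g : homeoI R) : tileM s (f * g)%g = (tileM s f * tileM s g)%g.
Proof.
apply: homeoR_eq => x; have [j [t [-> ts jp]]] := positive_cellP s x.
rewrite homeoRME !tileM_iso ?jp ?recenter_centered// /recenter addrK.
by rewrite homeoIME.
Qed.

Lemma tileM_inv s (f : homeoI R) : tileM s f^-1%g = (tileM s f)^-1%g.
Proof.
apply: (mulgI (tileM s f)); rewrite mulgV -tileM_mul mulgV.
apply: (mulgI (tileM s 1%g)); by rewrite -tileM_mul !mulg1.
Qed.

(** Here f is written in the coordinates of [iso], where a tile is centred at [ctr s]. It should
    satisfy [csupp s f], as [toI] otherwise returns the identity. *)
Definition cmove s f : homeoR R := tileM s (toI (f ^ affine 0 (1 / 2 - ctr s))%g).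

Definition csupp s f : Prop := supported (ctr s - 1 / 2) (ctr s + 1 / 2) f.

Lemma csupp_subgroup s : subgroup [set f | csupp s f].
Proof. exact: supported_subgroup. Qed.

Lemma csupp_centered s f t : csupp s f -> centered s (f t) = centered s t.
Proof. by move=> fs; apply: supported_itv fs; lra. Qed.

Lemma half_csupp s f : supported 0 (1 / 2) f -> csupp s f.
Proof. by apply: supported_sub; case: s; rewrite /ctr; lra. Qed.

Lemma recenter_toI s f t : csupp s f ->
  recenter s (toI (f ^ affine 0 (1 / 2 - ctr s))%g) t = f t.
Proof.
move=> fs; rewrite /recenter toIE; last first.
  have := supported_conj (g := affine 0 (1 / 2 - ctr s)) fs.
  by apply: supported_sub; rewrite affineE expr0z; lra.
rewrite conjg_affine oppr0 !expr0z !mul1r.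
rewrite (_ : t - _ - _ = t); last by lra.
by lra.
Qed.

Lemma cmove_iso s f j t : csupp s f -> centered s t -> view j (idx s) ->
  cmove s f (iso j t) = iso j (f t).
Proof. by move=> fs ts jp; rewrite tileM_iso// jp recenter_toI. Qed.

Lemma cmoveM s f g : csupp s f -> csupp s g -> cmove s (f * g)%g = (cmove s f * cmove s g)%g.
Proof.
move=> fs gs; have fgs : csupp s (f * g)%g by exact: (subgroupM (csupp_subgroup s)).
apply: homeoR_eq => x; have [j [t [-> ts jp]]] := positive_cellP s x.
by rewrite homeoRME !cmove_iso// csupp_centered.
Qed.

Lemma cmoveV s f : csupp s f -> cmove s f^-1%g = (cmove s f)^-1%g.
Proof.
move=> fs; have fVs : csupp s f^-1%g by exact: (subgroupV (csupp_subgroup s)).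
have s1 : csupp s 1%g by exact: (subgroup1 (csupp_subgroup s)).
apply: (mulgI (cmove s f)); rewrite mulgV -cmoveM// mulgV.
by apply: (mulgI (cmove s 1%g)); rewrite -cmoveM// !mulg1.
Qed.

Lemma cmoveJ s f g : csupp s f -> csupp s g -> cmove s (f ^ g)%g = (cmove s f ^ cmove s g)%g.
Proof.
move=> fs gs; have gVs : csupp s g^-1%g by exact: (subgroupV (csupp_subgroup s)).
by rewrite !conjgE !cmoveM ?cmoveV//; exact: (subgroupM (csupp_subgroup s)).
Qed.

(** The interval [n, n + 1] is made of the cells (n, false) and (n + 1, true), the second read from
    its right end; for f supported in [0, 1/2] the two factors act on different halves. *)
Definition on_cells A f : homeoR R :=
  tile 0 (fun n => (if A (n, false) then toI f else 1) *
                   (if A (n + 1, true) then iota_conj (toI f) else 1))%g.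

Lemma on_cells_iso A f j t : supported 0 (1 / 2) f -> 0 <= t <= 1 / 2 ->
  on_cells A f (iso j t) = iso j (if A j then f t else t).
Proof.
move=> fs tI; have fI : toI f = f :> homeoR R.
  by apply: toIE; apply: supported_sub fs; lra.
have ftI : 0 <= f t <= 1 / 2 by rewrite supported_itv//; lra.
have [|f0 f1] := @supported_end R 0 (1 / 2) f _ fs; first by lra.
have oneI (u : R) : (1%g : homeoI R) u = u by [].
have fh u : 0 <= u <= 1 / 2 -> 1 - f (1 - u) = u.
  move=> uI; have [->|u12] := eqVneq u (1 / 2).
    by rewrite (_ : 1 - 1 / 2 = 1 / 2) ?f1; lra.
  rewrite fs ?subKr//; apply/negP => uI'; move/eqP: u12; apply; lra.
have fhV u : 0 <= u <= 1 / 2 -> f (1 - u) = 1 - u by move=> /fh; lra.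
case: j => n []; rewrite /on_cells /iso; cbn [fst snd].
  rewrite (@tileE _ _ _ (n - 1)); last by rewrite intrB mulr1z; lra.
  rewrite subrK homeoIME intrB mulr1z (_ : n%:~R - t - _ = 1 - t); last by lra.
  have -> : (if A (n - 1, false) then toI f else 1%g) (1 - t) = 1 - t.
    by case: ifP => // _; rewrite fI fhV.
  by case: ifP => _; rewrite ?iota_conjE ?fI ?subKr ?oneI; lra.
rewrite (@tileE _ _ _ n); last by lra.
rewrite homeoIME (_ : n%:~R + t - _ = t); last by lra.
have -> : (if A (n, false) then toI f else 1%g) t = if A (n, false) then f t else t.
  by case: ifP => // _; rewrite fI.
case: (A (n + 1, true)); rewrite ?iota_conjE ?fI ?oneI ?add0r//.
by rewrite fh//; case: ifP.
Qed.

(** Parameters beyond [0, 1/2] lie in the neighbouring cell, where nothing moves because it is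
    outside A. *)
Lemma on_cells_wide s A f j t : supported 0 (1 / 2) f -> centered s t ->
  ~~ A (nbr s j) -> on_cells A f (iso j t) = iso j (if A j then f t else t).
Proof.
move=> fs ts nA; have [tI|tI] := boolP (0 <= t <= 1 / 2); first exact: on_cells_iso.
rewrite fs// if_same -[t](subKr (2 * ctr s)) -iso_nbr on_cells_iso ?(negbTE nA)//.
by move: ts tI; rewrite negb_and -!ltNge /centered /ctr; case: s {nA}; lra.
Qed.

Lemma on_cells_eq A B f g : supported 0 (1 / 2) f -> supported 0 (1 / 2) g ->
  (forall j, (if A j then f else 1%g) = (if B j then g else 1%g)) ->
  on_cells A f = on_cells B g.
Proof.
move=> fs gs AB; apply: homeoR_eq => x; have [j [t [-> tI]]] := cellP x.
rewrite !on_cells_iso//; congr iso.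
by have := congr1 (fun h : homeoR R => h t) (AB j); case: ifP; case: ifP.
Qed.

Lemma on_cellsM A B C f g h :
  supported 0 (1 / 2) f -> supported 0 (1 / 2) g -> supported 0 (1 / 2) h ->
  (forall j, (if C j then h else 1) = (if A j then f else 1) * (if B j then g else 1))%g ->
  on_cells C h = (on_cells A f * on_cells B g)%g.
Proof.
move=> fs gs hs AB; apply: homeoR_eq => x; have [j [t [-> tI]]] := cellP x.
rewrite homeoRME !on_cells_iso//; last first.
  by case: ifP; rewrite ?supported_itv//; lra.
congr iso; have := congr1 (fun h : homeoR R => h t) (AB j).
by rewrite homeoRME; do 3!case: ifP.
Qed.

Lemma on_cells1 A : on_cells A 1%g = 1%g.
Proof.
have s1 : supported 0 (1 / 2) (1%g : homeoR R) by [].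
apply: (mulgI (on_cells A 1%g)); rewrite mulg1; apply/esym.
by apply: on_cellsM => // j; case: ifP; rewrite mulg1.
Qed.

Lemma on_cellsV A f : supported 0 (1 / 2) f -> on_cells A f^-1%g = (on_cells A f)^-1%g.
Proof.
move=> fs; have fVs : supported 0 (1 / 2) f^-1%g.
  exact: (subgroupV (supported_subgroup _ _)).
apply: (mulgI (on_cells A f)); rewrite mulgV -(on_cells1 A); apply/esym.
by apply: on_cellsM => // j; case: ifP; rewrite ?mulgV ?mulg1.
Qed.

Lemma on_cellsJ A f g : supported 0 (1 / 2) f -> supported 0 (1 / 2) g ->
  on_cells A (f ^ g)%g = (on_cells A f ^ on_cells A g)%g.
Proof.
move=> fs gs; have sG := supported_subgroup (0 : R) (1 / 2).
rewrite !conjgE -on_cellsV//.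
rewrite (@on_cellsM A A A g^-1 (f * g))%g; first last.
- by move=> j; case: ifP; rewrite ?mulg1.
- by apply: (subgroupM sG); [exact: (subgroupV sG)|exact: (subgroupM sG)].
- exact: (subgroupM sG).
- exact: (subgroupV sG).
congr (_ * _)%g; apply: on_cellsM => //; first exact: (subgroupM sG).
by move=> j; case: ifP; rewrite ?mulg1.
Qed.

(** On a cell in only one of A and B one of the two factors is the identity, so the commutator
    vanishes there. *)
Lemma on_cellsR A B f g : supported 0 (1 / 2) f -> supported 0 (1 / 2) g ->
  on_cells (predI A B) [~ f, g]%g = [~ on_cells A f, on_cells B g]%g.
Proof.
move=> fs gs; have sG := supported_subgroup (0 : R) (1 / 2).
have fVs : supported 0 (1 / 2) f^-1%g := subgroupV sG fs.
have gVs : supported 0 (1 / 2) g^-1%g := subgroupV sG gs.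
have fgs : supported 0 (1 / 2) [~ f, g]%g := subgroupR sG fs gs.
rewrite [RHS]commgEl conjgE -!on_cellsV//.
apply: homeoR_eq => x; have [j [t [-> tI]]] := cellP x.
have pres C h u : supported 0 (1 / 2) h -> 0 <= u <= 1 / 2 ->
    0 <= (if C then h u else u) <= 1 / 2.
  by move=> hs uI; case: C => //; rewrite supported_itv//; lra.
rewrite !homeoRME !on_cells_iso ?pres//.
by congr iso; rewrite /=; case: (A j); case: (B j); rewrite /= ?homeoRKV.
Qed.

(** A cell of A reads its tile positively, so its neighbour in the tile is outside A and [cmove s g]
    acts in its coordinates as g. When g carries the support of f to the other half of the tile, the
    conjugate acts on the neighbouring cells, whose coordinates are the reflected ones. *)
Lemma on_cells_conj s A f g : (forall j, A j -> view j (idx s)) ->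
  supported 0 (1 / 2) f -> csupp s g ->
  supported 0 (1 / 2) (mirror (2 * ctr s) (f ^ g)%g) ->
  (on_cells A f ^ cmove s g)%g =
  on_cells (fun j => A (nbr s j)) (mirror (2 * ctr s) (f ^ g)%g).
Proof.
move=> Ap fs gs fgs; rewrite conjgE.
apply: (mulgI (cmove s g)); rewrite mulVKg.
apply: homeoR_eq => x; have [j [t [-> ts jp]]] := positive_cellP s x.
have nA : ~~ A (nbr s j).
  apply: contraL jp => /Ap; rewrite view_nbr (_ : 2 * idx s - idx s = idx s)//; lia.
rewrite !homeoRME (on_cells_wide fs ts nA) !cmove_iso//; last first.
  by case: ifP => // _; rewrite csupp_centered//; exact: half_csupp.
rewrite -[in RHS](subKr (2 * ctr s) (g t)) -iso_nbr (@on_cells_wide s)//; first last.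
- by rewrite nbrK.
- by rewrite centered_mirror csupp_centered.
cbv beta; rewrite nbrK iso_nbr; case: ifP => _; last by rewrite subKr.
by rewrite mirrorE !subKr conjgE 2!homeoRME homeoRVK.
Qed.

End Cells.

Lemma int_parity (q : int) : exists m, q = 2 * m \/ q = 2 * m + 1.
Proof.
exists (q %/ 2)%Z; have := divz_eq q 2; have := modz_ge0 q (isT : (2 : int) != 0).
by have := ltz_pmod q (isT : (0 : int) < 2); lia.
Qed.

(** * Windows of labels: reversed and syndetic occurrences *)

Section QuasiPeriodic.
Variable rho : int -> letter.
Hypothesis rhoP : labelling rho.
Local Notation view := (view rho).

Lemma labelling_even q m : rho q = rho (2 * m) \/ rho q = letter_inv (rho (2 * m)) ->
  exists n, q = 2 * n.
Proof.
have [n [->|->]] := int_parity q; first by exists n.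
have [_] := rhoP n; have [+ _] := rhoP m.
by rewrite !inE => /orP[] /eqP-> /orP[] /eqP -> [].
Qed.

Definition window (K : nat) (j0 j : cell) : bool :=
  all (fun i => view j i == view j0 i) [seq i%:Z - K%:Z | i <- iota 0 (K + K).+1].

Lemma windowP K j0 j :
  reflect (forall i, `|i| <= K%:Z -> view j i = view j0 i) (window K j0 j).
Proof.
apply: (iffP allP) => [h i iK|h i /mapP[n]].
  apply/eqP/h/mapP; exists (absz (i + K%:Z)); first by rewrite mem_iota; lia.
  by lia.
by rewrite mem_iota => nK ->; apply/eqP/h; lia.
Qed.

Lemma nth_block j n e : (e <= n)%N -> nth La (block_word rho j n) e = rho (j + e%:Z).
Proof. by move=> en; rewrite nth_mkseq. Qed.

(** The inverse of the word at the indices from -K to K occurs somewhere. Its centre carries an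
    a-letter, so it is an integer m, and reading leftwards from m undoes both the reversal and the
    inversion. *)
Lemma reversed_view K : quasi_periodic rho ->
  exists m, forall i, `|i| <= K%:Z -> view (m, true) i = view (0, false) i.
Proof.
move=> [_ /(_ (- K%:Z) (K + K)%N)[k [p kp]]].
have pE : p = (K + K)%N.
  have := congr1 size kp; rewrite size_rev size_map !size_mkseq; lia.
have rev_rho i : `|i| <= K%:Z -> rho (k + K%:Z - i) = letter_inv (rho i).
  move=> iK; have := congr1 (nth La ^~ (absz (K%:Z - i))) kp.
  rewrite nth_block ?pE; last by lia.
  rewrite nth_rev size_map size_mkseq; last by lia.
  rewrite (nth_map La) ?size_mkseq; last by lia.
  rewrite nth_block; last by lia.
  by move=> h; rewrite (_ : k + _ - _ = k + `|(K%:Z - i)|%N) ?h; [congr (letter_inv (rho _))|]; lia.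
have [|m mE] := @labelling_even (k + K%:Z) 0.
  by right; have := rev_rho 0; rewrite subr0 mulr0; apply; lia.
exists m => i iK; rewrite /view/= -mE rev_rho// positive_inv negbK.
by rewrite mulr0 add0r.
Qed.

Lemma window_syndetic K j0 : quasi_periodic rho ->
  exists L, forall n, exists2 d, (d <= L)%N & window K j0 (n + d%:Z, j0.2).
Proof.
case: j0 => n0 o0 [/(_ (2 * n0 - K%:Z) (K + K)%N)[L HL] _].
exists (L.+1 + K)%N => n; have /infixP[s1 [s2 E]] := HL (2 * n) L (leqnSn L).
have sz := congr1 size E; rewrite !size_cat !size_mkseq in sz.
have eq_rho i : `|i| <= K%:Z -> rho (2 * n + (size s1)%:Z + K%:Z + i) = rho (2 * n0 + i).
  move=> iK; have [e eE] : exists e : nat, e%:Z = K%:Z + i by exists (absz (K%:Z + i)); lia.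
  have : nth La (block_word rho (2 * n) L) (size s1 + e) =
    nth La (s1 ++ block_word rho (2 * n0 - K%:Z) (K + K) ++ s2) (size s1 + e) by rewrite E.
  rewrite nth_block; last by lia.
  rewrite nth_cat ltnNge leq_addr addKn nth_cat size_mkseq.
  rewrite (_ : (_ < _)%N); last by lia.
  rewrite nth_block; last by lia.
  move=> h; transitivity (rho (2 * n + (size s1 + e)%N%:Z)); first by congr rho; lia.
  by rewrite h; congr rho; lia.
(* The centre of the occurrence carries the letter of index 2 n0, so its index is even and it is the
   integer endpoint of a cell. *)
have [|m mE] := @labelling_even (2 * n + (size s1)%:Z + K%:Z) n0.
  by left; have := eq_rho 0; rewrite !addr0; apply; lia.
exists (absz (m - n)); first by lia.
rewrite (_ : n + _ = m); last by lia.
apply/windowP => i iK; rewrite /view/=; case: o0; rewrite -mE.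
  by rewrite eq_rho//; lia.
by rewrite eq_rho.
Qed.

End QuasiPeriodic.

(** * Locality of the elements of the group *)

Section Local.
Variables (R : realType) (rho : int -> letter).
Hypothesis rhoP : labelling rho.
Implicit Types (s : bool) (t x : R) (k : R) (f g h : homeoR R) (j : cell).
Local Notation view := (view rho).

(* In the coordinates of a cell, h is determined by the labels within distance k. *)
Definition local k h : Prop := forall j j' t,
  (forall i : int, `|i%:~R / 2 - t| <= k -> view j i = view j' i) ->
  exists2 y, `|y - t| <= k & h (iso j t) = iso j y /\ h (iso j' t) = iso j' y.

Lemma localM k l f g : local k f -> local l g -> local (k + l) (f * g)%g.
Proof.
move=> fk gl j j' t jj.
have [i ik|y yt [fy fy']] := fk j j' t.
  apply: jj; apply: le_trans ik _; rewrite lerDl.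
  (* Locality of g forces 0 <= l, because l bounds a distance. *)
  by have [z zt _] := gl j j t (fun i _ => erefl); apply: le_trans zt.
have [i il|z zy [gz gz']] := gl j j' y.
  by apply: jj; move: il yt; rewrite !ler_norml; lra.
exists z; first by move: zy yt; rewrite !ler_norml; lra.
by rewrite !homeoRME fy fy'.
Qed.

Lemma isoV j : exists j', forall t, iso j (iso j' t) = t.
Proof.
case: j => n []; first by exists (n, true) => t; rewrite /iso/= subKr.
by exists (- n, false) => t; rewrite /iso/= mulrNz; lra.
Qed.

Lemma isoM j j' : exists j'', forall t, iso j (iso j' t) = iso j'' t.
Proof.
case: j j' => n [] [m []].
- by exists (n - m, false) => t; rewrite /iso/= intrB; lra.
- by exists (n - m, true) => t; rewrite /iso/= intrB; lra.
- by exists (n + m, true) => t; rewrite /iso/= intrD; lra.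
- by exists (n + m, false) => t; rewrite /iso/= intrD; lra.
Qed.

Lemma iso_onto j x : exists t, x = iso j t.
Proof. by have [j' h] := isoV j; exists (iso j' x). Qed.

(** The preimage of a point is within k of it, so the labels within 2k of the point include those
    that determine f near the preimage. *)
Lemma localV k f : local k f -> local (k + k) f^-1%g.
Proof.
move=> fk j j' t jj; have [s fs] := iso_onto j (f^-1%g (iso j t)).
have [y ys [fy _]] := fk j j s (fun i _ => erefl).
have yt : y = t by apply: (@iso_inj R j); rewrite -fy -fs homeoRKV.
rewrite {}yt in ys fy.
have [i ik|z zs [fz fz']] := fk j j' s.
  by apply: jj; move: ik ys; rewrite !ler_norml; lra.
have zt : z = t by apply: (@iso_inj R j); rewrite -fz fy.
exists s; first by move: ys; rewrite !ler_norml; lra.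
by split=> //; rewrite -zt -fz' homeoRVK.
Qed.

Lemma local_subgroup : subgroup [set h | exists k, local k h].
Proof.
apply: mk_subgroup => [|f g /= [k fk] [l gl]].
  by exists 0 => j j' t _; exists t => //; rewrite subrr normr0.
exists (k + (l + l)); exact: localM fk (localV gl).
Qed.

(** A tile has length 1 and its label sits at its centre, so radius 1 covers the label as well as
    the displacement. *)
Lemma local_tileM s (f : homeoI R) : local 1 (tileM rho s f).
Proof.
move=> j j' t jj; have [m mt] := centered_decomp s t.
pose u := t - m%:~R; have ut : t = m%:~R + u by rewrite /u; lra.
pose y := if view j (2 * m + idx s) then recenter s f u
         else 2 * ctr R s - recenter s f (2 * ctr R s - u).
have yc : centered s y.
  rewrite /y; case: ifP => _; first exact: recenter_centered.
  by rewrite centered_mirror recenter_centered// centered_mirror.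
exists (m%:~R + y).
  by move: yc mt; rewrite /centered /u ler_norml; lra.
have hm : view j (2 * m + idx s) = view j' (2 * m + idx s).
  apply: jj; rewrite ler_norml intrD intrM; move: mt; rewrite /centered /ctr /idx.
  by case: s {y yc} => /=; rewrite ?mulr1z ?mulr0z; lra.
by rewrite ut -!iso_shift !tileM_iso// !view_shift -hm.
Qed.

End Local.

(** * Homeomorphisms preserving every orbit of the integral isometries *)

Section Displacement.
Variable R : realType.
Implicit Types (x y : R) (n : int) (h : homeoR R).

Lemma homeoR_cont h x e : 0 < e ->
  exists2 d, 0 < d & forall y, `|y - x| < d -> `|h y - h x| < e.
Proof.
move=> e0; have [_ /(_ x) hc _] := homeoRP h.
move/cvgrPdist_lt : hc => /(_ e e0)[d /= d0 hd]; exists d => // y yd.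
by rewrite distrC; apply: hd; rewrite /= distrC.
Qed.

Lemma int_lt1_eq (m n : int) : `|m%:~R - n%:~R : R| < 1 -> m = n.
Proof. by rewrite -intrB -intr_norm -[1]/(1%:~R) ltr_int; lia. Qed.

Lemma int_dist x : (forall n, x <> n%:~R) ->
  exists2 e, 0 < e & forall n, e <= `|x - n%:~R|.
Proof.
move=> xn; have := floor_itv x; rewrite intrD mulr1z; set m := Num.floor x => /andP[mx xm].
have {}mx : m%:~R < x by rewrite lt_neqAle mx andbT eq_sym; apply/eqP.
exists (Num.min (x - m%:~R) (m%:~R + 1 - x)); first by rewrite lt_min; lra.
move=> n; have [nm|mn] := lerP n m.
  rewrite ge_min; apply/orP; left; rewrite -(ler_int R) in nm.
  by rewrite ger0_norm; lra.
rewrite ge_min; apply/orP; right; move: mn; rewrite -lezD1 -(ler_int R) intrD mulr1z => mn.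
by rewrite ler0_norm; lra.
Qed.

(** Suppose each h x is n + x or n - x. If h x - x is not an integer, continuity makes h z + z the
    same integer for all z near x, and h would decrease there. So h x - x is continuous and
    integer-valued, hence constant. *)
Lemma translation_or_free h : (exists n, forall x, h x = x + n%:~R) \/
  exists x, forall j : cell, h x <> iso j x.
Proof.
have [[x hx]|/forallNP H] := pselect (exists x, forall j : cell, h x <> iso j x); first by right; exists x.
left; have {}H x : (exists n, h x - x = n%:~R) \/ (exists n, h x + x = n%:~R).
  have /existsNP[[n o] /contrapT] := H x; rewrite /iso/=.
  by case: o => ->; [right|left]; exists n; lra.
have int_disp x : exists n, h x - x = n%:~R.
  apply: contrapT => /forallNP/int_dist[e e0 he].
  have [d d0 hd] := @homeoR_cont h x (Num.min (e / 2) (1 / 2)) ltac:(rewrite lt_min; lra).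
  pose z := x + Num.min d (Num.min (e / 2) (1 / 2)) / 2.
  have m0 : 0 < Num.min d (Num.min (e / 2) (1 / 2)) by rewrite !lt_min; lra.
  have : z - x < Num.min d (Num.min (e / 2) (1 / 2)) by rewrite /z; lra.
  rewrite !lt_min => /and3P[zd ze z1]; have xz : x < z by rewrite /z; lra.
  have := hd z; rewrite ger0_norm ?subr_ge0 ?(ltW xz)// => /(_ zd).
  have hxz : h x < h z by rewrite homeoR_mono.
  rewrite ger0_norm ?subr_ge0 ?(ltW hxz)// lt_min => /andP[hze hz1].
  case: (H x) => -[n hn].
    by have := he n; rewrite hn subrr normr0; lra.
  case: (H z) => -[m hm].
    by have := he m; rewrite -hm leNgt ltr_norml => /negP[]; lra.
  have nm : m = n by apply: int_lt1_eq; rewrite -hm -hn ltr_norml; lra.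
  by move: hm; rewrite nm; lra.
have loc_const x : exists2 d, 0 < d & forall y, `|y - x| < d -> h y - y = h x - x.
  have [d d0 hd] := @homeoR_cont h x (1 / 2) ltac:(lra).
  exists (Num.min d (1 / 2)); first by rewrite lt_min; lra.
  move=> y; rewrite lt_min => /andP[yd y1].
  have [[n hn] [m hm]] := (int_disp y, int_disp x).
  rewrite hn hm; congr (_%:~R); apply: int_lt1_eq; rewrite -hn -hm.
  by move: (hd y yd) y1; rewrite !ltr_norml; lra.
have const x : forall y, x <= y -> h y - y = h x - x.
  apply: (@real_induction _ _ x) => [y yx|y IH]; first by lra.
  have [d d0 hd] := loc_const y.
  have [yx|xy] := ltP y x.
    by exists (x - y); [lra|move=> z zx xz; lra].
  have Py : h y - y = h x - x.
    move: xy; rewrite le_eqVlt => /predU1P[->//|xy].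
    pose z := Num.max x (y - d / 2).
    have zy : z < y by rewrite gt_max xy; lra.
    have xz : x <= z by rewrite le_max lexx.
    have dz : y - d / 2 <= z by rewrite le_max lexx orbT.
    by rewrite -(hd z) ?IH// ltr_norml; lra.
  exists d => // z zd xz; have [zy|yz] := ltP z y; first exact: IH.
  by rewrite hd// ltr_norml; lra.
have [n hn] := int_disp 0; exists n => x; rewrite -hn.
have [x0|x0] := leP 0 x; first by have := const 0 x x0; lra.
by have := const x 0 (ltW x0); lra.
Qed.

End Displacement.

(** * Local actions contained in a normal subgroup *)

Section Simplicity.
Variables (R : realType) (rho : int -> letter) (G : set (homeoR R)).
Hypotheses (rhoP : labelling rho) (rhoQ : quasi_periodic rho).
Hypothesis conj_into : forall (u v r s : R) f, PLc u v f -> u <= r -> r < s -> s <= v ->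
  exists2 g, PLc u v g & PLc r s (f ^ g)%g.
Hypothesis PLc_perfect : forall u v : R, u < v -> PLc u v `<=` derived (PLc u v : set (homeoR R)).
Hypothesis GG : subgroup G.
Hypothesis Gmove : forall s f, PLc (ctr R s - 1 / 2) (ctr R s + 1 / 2) f -> G (cmove rho s f).
Implicit Types (s : bool) (t x u : R) (f g h : homeoR R) (j : cell) (A B C : pred cell).
Implicit Types (N : set (homeoR R)).
Local Notation view := (view rho).
Local Notation on_cells := (@on_cells R).
Local Notation supp2 := (supported (0 : R) (1 / 2)).
Local Notation PL2 := (PLc (0 : R) (1 / 2)).

Definition good N A : Prop := forall f, PL2 f -> N (on_cells A f).

Let PL2G : subgroup PL2. Proof. by apply: PLc_subgroup; lra. Qed.

Let s2G : subgroup [set f | supp2 f]. Proof. exact: supported_subgroup. Qed.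

Lemma good_ext N A B : A =1 B -> good N A -> good N B.
Proof.
move=> AB gA f fP; have fs := PLc_supported fP.
rewrite (@on_cells_eq _ B A f f)//; first exact: gA.
by move=> j; rewrite AB.
Qed.

Lemma on_cells_subgroup N A : subgroup N ->
  subgroup [set f | supp2 f /\ N (on_cells A f)].
Proof.
move=> NN; apply: mk_subgroup => [|f g /= [fs Nf] [gs Ng]].
  by split=> //; rewrite on_cells1; exact: (subgroup1 NN).
have gVs : supp2 g^-1%g := subgroupV s2G gs.
have fgs : supp2 (f / g)%g := subgroupMV s2G fs gs.
split=> //; rewrite (@on_cellsM _ A A A f g^-1%g)//.
  by rewrite on_cellsV//; exact: (subgroupMV NN).
by move=> j; case: ifP; rewrite ?mulg1.
Qed.

Lemma on_cells_derived N A u v : 0 <= u -> v <= 1 / 2 -> u < v -> subgroup N ->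
  (forall f g, PLc u v f -> PLc u v g -> N (on_cells A [~ f, g]%g)) ->
  forall f, PLc u v f -> N (on_cells A f).
Proof.
move=> u0 v1 uv NN H f fP.
have sub h : PLc u v h -> supp2 h.
  by move=> /PLc_supported; exact: supported_sub.
suff [] : supp2 f /\ N (on_cells A f) by [].
move: f fP => f /(PLc_perfect uv); move: f; apply: derived_min.
  exact: on_cells_subgroup.
by move=> f g fP gP; split; [apply: (subgroupR s2G); exact: sub|exact: H].
Qed.

(** By perfectness it suffices to treat commutators of maps, and these become commutators of an
    element of N with one of G. *)
Lemma goodI N A B : normal_subgroup N G -> good N A -> good G B -> good N (predI A B).
Proof.
move=> NG gA gB; have [NN _ _] := NG.
apply: (on_cells_derived _ _ _ NN); [lra|lra|lra|move=> f g fP gP].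
rewrite on_cellsR//; try exact: PLc_supported.
by apply: (normalR GG NG); [exact: gA|exact: gB].
Qed.

Lemma goodU N A B : subgroup N -> good N A -> good N B ->
  (forall j, A j -> ~~ B j) -> good N (predU A B).
Proof.
move=> NN gA gB AB f fP; have fs := PLc_supported fP.
rewrite (@on_cellsM _ A B (predU A B) f f f)//.
  by apply: (subgroupM NN); [exact: gA|exact: gB].
move=> j /=; case: (boolP (A j)) => [/AB/negbTE->|_]; first by rewrite mulg1.
by case: (B j); rewrite mul1g.
Qed.

Let GnG : normal_subgroup G G.
Proof. by split=> // x g; exact: subgroupJ. Qed.

Lemma good_sub N A : normal_subgroup N G -> good N A -> good G A.
Proof. by case=> _ NG _ gA f /gA/NG. Qed.

Let d2 s : dyadic (2 * ctr R s).
Proof.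
case: s; rewrite /ctr ?mulr0; last exact: (dyadic_int R 0).
by rewrite (_ : 2 * (1 / 2) = 1%:~R); [exact: dyadic_int|rewrite mulr1z; lra].
Qed.

Lemma mirror_halfP s f : PL2 f ->
  PLc (ctr R s - 1 / 2) (ctr R s + 1 / 2) (mirror (2 * ctr R s) f).
Proof.
by move=> /(PLc_mirror (d2 s)); apply: PLc_sub; case: s; rewrite /ctr; lra.
Qed.

Let centeredP s f : PLc (ctr R s - 1 / 2) (ctr R s + 1 / 2) f -> csupp s f.
Proof. exact: PLc_supported. Qed.

Let half_PLc s f : PL2 f -> PLc (ctr R s - 1 / 2) (ctr R s + 1 / 2) f.
Proof. by apply: PLc_sub; case: s; rewrite /ctr; lra. Qed.

(** A map on the neighbouring half of a tile is conjugated into the half of the positive cell; the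
    conjugator, read in positive coordinates, is a [cmove] and thus belongs to G. *)
Lemma good_nbr_positive N s A : normal_subgroup N G -> (forall j, A j -> view j (idx s)) ->
  good N A -> good N (fun j => A (nbr s j)).
Proof.
move=> NG Ap gA f fP.
have [|||g gP fgP] := @conj_into _ _ 0 (1 / 2) _ (mirror_halfP s fP).
- by case: s {Ap}; rewrite /ctr; lra.
- by lra.
- by case: s {Ap}; rewrite /ctr; lra.
have cG : subgroup (PLc (ctr R s - 1 / 2) (ctr R s + 1 / 2)).
  by apply: PLc_subgroup; lra.
have gVP := subgroupV cG gP.
have fE : mirror (2 * ctr R s) ((mirror (2 * ctr R s) f ^ g) ^ g^-1)%g = f.
  by rewrite conjgK mirrorK.
have := @on_cells_conj _ _ rhoP s A _ g^-1%g Ap (PLc_supported fgP) (centeredP gVP).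
rewrite fE => <-; last exact: PLc_supported.
by apply: (normalJ NG); [exact: gA|exact: Gmove].
Qed.

(** Now the neighbours are the positive cells, so the conjugation starts from them, lands in A, and
    is then inverted. *)
Lemma good_nbr_negative N s A : normal_subgroup N G -> (forall j, A j -> ~~ view j (idx s)) ->
  good N A -> good N (fun j => A (nbr s j)).
Proof.
move=> NG An gA f fP.
have Bp j : A (nbr s j) -> view j (idx s).
  move=> /An; rewrite view_nbr (_ : 2 * idx s - idx s = idx s) ?negbK//; lia.
have [|||g gP fgP] := @conj_into _ _ (2 * ctr R s - 1 / 2) (2 * ctr R s) _ (half_PLc s fP).
- by case: s {An Bp}; rewrite /ctr; lra.
- by lra.
- by case: s {An Bp}; rewrite /ctr; lra.
have mP : PL2 (mirror (2 * ctr R s) (f ^ g)%g).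
  by have := PLc_mirror (d2 s) fgP; apply: PLc_sub; lra.
have E := @on_cells_conj _ _ rhoP s (fun j => A (nbr s j)) f g Bp (PLc_supported fP)
  (centeredP gP) (PLc_supported mP).
rewrite -[on_cells _ f](conjgK (cmove rho s g)) E; apply: (normalJ NG).
  by apply: (@good_ext N A) => // j; rewrite nbrK.
by apply: (subgroupV GG); exact: Gmove.
Qed.

Lemma on_cells_view s f : PL2 f ->
  on_cells (fun j => view j (idx s)) f = cmove rho s f.
Proof.
move=> /PLc_supported fs; apply: homeoR_eq => x.
have [j [t [-> ts jp]]] := positive_cellP rho s x.
rewrite (@on_cells_wide _ s)//; last first.
  rewrite view_nbr (_ : 2 * idx s - idx s = idx s) ?jp//; lia.
by rewrite jp (cmove_iso rhoP)//; exact: half_csupp.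
Qed.

Lemma good_view_idx s : good G (fun j => view j (idx s)).
Proof. by move=> f fP; rewrite on_cells_view//; apply: Gmove; exact: half_PLc. Qed.

Lemma good_not_view_idx s : good G (fun j => ~~ view j (idx s)).
Proof.
apply: good_ext (@good_nbr_positive _ s _ GnG _ (@good_view_idx s)) => // j; cbv beta.
rewrite view_nbr (_ : 2 * idx s - idx s = idx s)//; lia.
Qed.

Lemma good_true : good G xpredT.
Proof.
apply: good_ext (goodU GG (@good_view_idx true) (@good_not_view_idx true) _) => j /=.
  by case: (view _ _).
by move->.
Qed.

Lemma goodC A : good G A -> good G (predC A).
Proof.
move=> gA f fP; have fs := PLc_supported fP.
rewrite (@on_cellsM _ xpredT A (predC A) f f^-1%g f)//; first last.
- by move=> j /=; case: (A j); rewrite /= ?mulgV ?mulg1.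
- exact: (subgroupV s2G).
by apply: (subgroupM GG); [exact: good_true|apply: gA; exact: (subgroupV PL2G)].
Qed.

Lemma goodUI N A B : normal_subgroup N G -> good N A -> good N B -> good N (predU A B).
Proof.
move=> NG gA gB; have [NN _ _] := NG.
apply: good_ext (goodU NN gA (goodI NG gB (goodC (good_sub NG gA))) _) => j /=.
  by case: (A j) => //=; rewrite andbT.
by move=> ->; rewrite andbF.
Qed.

Lemma good_nbr N s A : normal_subgroup N G -> good N A -> good N (fun j => A (nbr s j)).
Proof.
move=> NG gA.
pose A1 := predI A (fun j => view j (idx s)); pose A2 := predI A (fun j => ~~ view j (idx s)).
have g1 : good N (fun j => A1 (nbr s j)).
  apply: good_nbr_positive => //; first by move=> j /andP[].
  by apply: goodI => //; exact: good_view_idx.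
have g2 : good N (fun j => A2 (nbr s j)).
  apply: good_nbr_negative => //; first by move=> j /andP[].
  by apply: goodI => //; exact: good_not_view_idx.
apply: good_ext (goodUI NG g1 g2) => j /=.
by rewrite -andb_orr orbN andbT.
Qed.

(** Passing to a neighbour reflects the index of a label by i |-> -i or i |-> 2 - i. These
    reflections generate the translations by 2, so the indices 0 and 1 suffice as a start. *)
Lemma good_view i : good G (fun j => view j i).
Proof.
have step s k : good G (fun j => view j k) -> good G (fun j => view j (2 * idx s - k)).
  move=> gk; apply: good_ext (goodC (good_nbr s GnG gk)) => j /=.
  by rewrite view_nbr negbK.
have pos (n : nat) : good G (fun j => view j n%:Z) /\ good G (fun j => view j n.+1%:Z).
  elim: n => [|n [gn gn1]].
    by split; [exact: (@good_view_idx false)|exact: (@good_view_idx true)].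
  split=> //; have := step true _ (step false _ gn).
  by apply: good_ext => j; congr (view j); rewrite /idx; lia.
case: i => n; first by case: (pos n).
have := step false _ (pos n).2.
by apply: good_ext => j; congr (view j); rewrite /idx; lia.
Qed.

Lemma good_window K j0 : good G (window rho K j0).
Proof.
rewrite /window; elim: [seq _ | _ <- _] => [|i r IH]; first exact: good_true.
have gi : good G (fun j => view j i == view j0 i).
  case: (view j0 i).
    by apply: good_ext (good_view i) => j; rewrite eqb_id.
  by apply: good_ext (goodC (good_view i)) => j; rewrite eqbF_neg.
exact: goodI GnG gi IH.
Qed.

Definition enlarge A : pred cell :=
  predU A (predU (fun j => A (nbr false j)) (fun j => A (nbr true j))).

Lemma enlargeE A j : enlarge A j = [|| A j, A (nbr false j) | A (nbr true j)].
Proof. by []. Qed.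

Lemma good_iter_enlarge N A n : normal_subgroup N G -> good N A -> good N (iter n enlarge A).
Proof.
move=> NG gA; elim: n => //= n IH.
by apply: goodUI => //; apply: goodUI => //; exact: good_nbr.
Qed.

Lemma iter_enlarge_leq A m n j : (m <= n)%N -> iter m enlarge A j -> iter n enlarge A j.
Proof.
by move=> /subnKC <-; elim: (n - m)%N => [|k IH]; rewrite ?addn0// addnS iterS enlargeE => /IH ->.
Qed.

Lemma iter_enlarge_nbr s A n j : iter n enlarge A (nbr s j) -> iter n.+1 enlarge A j.
Proof. by rewrite iterS enlargeE => h; case: s h => ->; rewrite !orbT. Qed.

(** A unit translation of a cell consists of two moves to a neighbour, one across each kind of
    endpoint. *)
Lemma iter_enlarge_shift A d o : forall n : int, A (n + d%:Z, o) -> iter (2 * d)%N enlarge A (n, o).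
Proof.
elim: d => [|d IH] n; first by rewrite addr0.
rewrite (_ : n + d.+1%:Z = n + 1 + d%:Z); last by lia.
move=> /IH h; rewrite mulnS add2n; case: o h {IH} => h.
  apply: (@iter_enlarge_nbr false); apply: (@iter_enlarge_nbr true).
  by rewrite /nbr /=.
apply: (@iter_enlarge_nbr true); apply: (@iter_enlarge_nbr false).
by rewrite /nbr /=.
Qed.

Lemma good_window_true N K j0 : normal_subgroup N G -> good N (window rho K j0) -> good N xpredT.
Proof.
move=> NG gW; have [L HL] := window_syndetic rhoP K j0 rhoQ.
(* Up to 2 L moves reach a window cell of the same direction; one more serves the cells of the
   opposite direction. *)
apply: good_ext (good_iter_enlarge (2 * L).+1 NG gW) => -[n o].
have [d dL Wd] := HL n.
have := iter_enlarge_shift Wd; set o0 := j0.2 => h.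
have [->|oo] := eqVneq o o0.
  by apply: (iter_enlarge_leq _ h); lia.
apply: (@iter_enlarge_leq _ (2 * d).+1); first by lia.
apply: (@iter_enlarge_nbr false); rewrite /nbr /=.
by rewrite (_ : ~~ o = o0)//; move: oo; case: o; case: o0 {h}.
Qed.

Lemma good_true_cmove N s f : normal_subgroup N G -> good N xpredT ->
  PLc (ctr R s - 1 / 2) (ctr R s + 1 / 2) f -> N (cmove rho s f).
Proof.
move=> NG gT fP; have [|||g gP fgP] := @conj_into _ _ 0 (1 / 2) _ fP.
- by case: s {fP}; rewrite /ctr; lra.
- by lra.
- by case: s {fP}; rewrite /ctr; lra.
have gv : good N (fun j => view j (idx s)).
  exact: good_ext (goodI NG gT (@good_view_idx s)).
have := gv _ fgP; rewrite on_cells_view// (cmoveJ rhoP (centeredP fP) (centeredP gP)) => Nfg.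
rewrite -[cmove rho s f](conjgK (cmove rho s g)); apply: (normalJ NG) => //.
by apply: (subgroupV GG); exact: Gmove.
Qed.

Lemma on_cells_moved A f u v x : 0 <= u -> v <= 1 / 2 -> PLc u v f -> on_cells A f x <> x ->
  exists j t, [/\ x = iso j t, A j & u < t < v].
Proof.
move=> u0 v1 [fP [p [q [up pq qv fs]]]]; have [j [t [-> tI]]] := cellP x.
have f2 : supp2 f by apply: supported_sub fs; lra.
rewrite on_cells_iso// => moved; exists j, t.
have [Aj|nA] := boolP (A j); last by rewrite (negbTE nA) in moved.
rewrite Aj in moved; split => //.
have [|tpq] := boolP (p <= t <= q); first by lra.
by case: moved; rewrite fs.
Qed.

(** The orbit of x under the maps [iso j] is discrete, so h x keeps a positive distance e from it,
    and continuity extends this to a small interval around x. One side of x may be cut off to stay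
    inside a single cell. *)
Lemma free_interval h x : (forall j, h x <> iso j x) ->
  exists j0 u v, [/\ 0 <= u, u < v, v <= 1 / 2 &
    forall t t' j, u < t < v -> u < t' < v -> h (iso j0 t) <> iso j t'].
Proof.
move=> hx.
have [e e0 [ep em]] : exists2 e : R, 0 < e & (forall n : int, e <= `|h x - x - n%:~R|) /\
    (forall n : int, e <= `|h x + x - n%:~R|).
  have [|e e0 he] := @int_dist R (h x - x).
    by move=> n hn; apply: (hx (n, false)); rewrite /iso/=; lra.
  have [|d d0 hd] := @int_dist R (h x + x).
    by move=> n hn; apply: (hx (n, true)); rewrite /iso/=; lra.
  exists (Num.min e d); first by rewrite lt_min e0.
  by split=> n; rewrite ge_min ?he ?hd ?orbT.
have [d d0 hd] := @homeoR_cont R h x (e / 4) ltac:(lra).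
have [j0 [t0 [xE t0I]]] := cellP x.
pose r := Num.min d (e / 4).
have r0 : 0 < r by rewrite lt_min; lra.
have rd : r <= d by rewrite ge_min lexx.
have re : r <= e / 4 by rewrite ge_min lexx orbT.
exists j0, (Num.max 0 (t0 - r)), (Num.min (1 / 2) (t0 + r)).
split; first by rewrite le_max lexx.
- by rewrite gt_max !lt_min; lra.
- by rewrite ge_min lexx.
have close t : Num.max 0 (t0 - r) < t < Num.min (1 / 2) (t0 + r) -> `|iso j0 t - x| < r.
  rewrite gt_max lt_min xE ltr_norml /iso => tI; case: ifP => _; lra.
move=> t t' j /close tc /close tc' htj.
(* The maps [iso] form a group, so iso j t' can be rewritten as an isometry j1 applied to iso j0 t',
   a point close to x. *)
have [i iE] := isoV R j0; have [j1 j1E] := isoM R j i.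
have t'E : iso j t' = iso j1 (iso j0 t').
  have [i' i'E] := isoV R i; rewrite -j1E; congr iso.
  by apply: (@iso_inj R j0); rewrite iE.
rewrite {}t'E in htj; move: htj tc'; set y := iso j0 t' => htj yc.
have := hd (iso j0 t) (lt_le_trans tc rd); rewrite htj => hc.
case: j1 {j1E htj} hc => n []; rewrite /iso/= => hc.
  have := em n; rewrite leNgt => /negP; apply.
  by move: hc yc; rewrite !ltr_norml; lra.
have := ep n; rewrite leNgt => /negP; apply.
by move: hc yc; rewrite !ltr_norml; lra.
Qed.

Lemma good_of_free N h k x : normal_subgroup N G -> N h -> local rho k h ->
  (forall j, h x <> iso j x) -> exists K j0, good N (window rho K j0).
Proof.
move=> NG Nh hk /free_interval[j0 [u [v [u0 uv v1 hfree]]]].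
have [NN NsG _] := NG.
(* Labels are spaced by 1/2 and t lies in [0, 1/2], so distance at most k from t means an index of
   size at most 2 k + 1. *)
pose K := (Num.truncn (2 * (`|k| + 1))).+1; pose A := window rho K j0.
exists K, j0.
have same j t : A j -> u < t < v ->
    exists y, h (iso j0 t) = iso j0 y /\ h (iso j t) = iso j y.
  move=> Aj tI; have [i ik|y _ hy] := hk j0 j t; last by exists y.
  apply/esym; move/windowP : Aj; apply.
  have : `|i%:~R : R| <= K%:R.
    apply: (@le_trans _ _ (2 * (`|k| + 1))); last first.
      by rewrite ltW// truncnS_gt.
    have := ler_norm k; move: ik; rewrite !ler_norml; lra.
  by rewrite -intr_norm pmulrn ler_int.
have Ncomm f g : PLc u v f -> PLc u v g -> N (on_cells A [~ f, g]%g).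
  move=> fP gP.
  have sub f' : PLc u v f' -> PL2 f' by exact: PLc_sub.
  have gA := good_window K j0.
  rewrite (@on_cells_eq _ A (predI A A) _ [~ f, g]%g); first last.
  - by move=> j /=; rewrite andbb.
  - by apply: (subgroupR s2G); exact/PLc_supported/sub.
  - by apply: (subgroupR s2G); exact/PLc_supported/sub.
  rewrite on_cellsR; [|exact/PLc_supported/sub|exact/PLc_supported/sub].
  set a := on_cells A f; set c := on_cells A g.
  (* On every cell of A the map h repeats what it does on j0. If it carried a moved point of one
     such cell into the interval (u, v) of another, transport back to j0 would contradict
     [hfree]. *)
  have disj f' : PLc u v f' -> commute (a ^ h)%g (on_cells A f').
    move=> f'P; apply: commute_disjoint => z.
    have [|/(on_cells_moved u0 v1 f'P)[j' [t' [zE Aj' t'I]]]] := pselect (on_cells A f' z = z).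
      by right.
    left; rewrite conjgE 2!homeoRME; apply: contrapT => moved.
    have /(on_cells_moved u0 v1 fP)[j [t [wE Aj tI]]] : a (h^-1%g z) <> h^-1%g z.
      by move=> fixed; apply: moved; rewrite fixed homeoRKV.
    have [y [y0 yj]] := same j t Aj tI.
    have zy : iso j y = iso j' t' by rewrite -yj -wE homeoRKV.
    have [i iE] := isoV R j; have [i' i'E] := isoV R i.
    have [m mE] := isoM R j0 i; have [m' m'E] := isoM R m j'.
    apply: (hfree t t' m' tI t'I); rewrite y0 -m'E -zy -mE; congr iso.
    by apply: (@iso_inj R j); rewrite iE.
  rewrite -(@displaced_commutator _ a c h); [|exact: disj|exact: disj].
  apply: (normalR GG NG); last by apply: gA; exact: sub.
  apply: (normalRr GG NG) => //; apply: (subgroupV GG).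
  by apply: gA; exact: sub.
move=> f fP; have [g gP fgP] := conj_into fP u0 uv v1.
have := on_cells_derived u0 v1 uv NN Ncomm fgP.
rewrite on_cellsJ; [|exact: PLc_supported|exact: PLc_supported] => Nfg.
rewrite -[on_cells A f](conjgK (on_cells A g)); apply: (normalJ NG) => //.
by apply: (subgroupV GG); exact: good_window.
Qed.

Hypothesis Glocal : forall h, G h -> exists k, local rho k h.

(** A long enough word around 0 occurs reversed around some m. Locality makes the cells (0, false)
    and (m, true) move the same way in their own coordinates, so a translation goes by n and by
    -n. *)
Lemma local_translation h k n : local rho k h -> (forall x, h x = x + n%:~R) -> n = 0.
Proof.
move=> hk hn; pose K := (Num.truncn (2 * `|k|)).+1.
have [m mview] := reversed_view rhoP K rhoQ.
have [i ik|y _ [y1 y2]] := hk (0, false) (m, true) 0.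
  apply/esym/mview; have : `|i%:~R : R| <= K%:R.
    apply: (@le_trans _ _ (2 * `|k|)); last by rewrite ltW// truncnS_gt.
    have := ler_norm k; move: ik; rewrite subr0 !ler_norml; lra.
  by rewrite -intr_norm pmulrn ler_int.
move: y1 y2; rewrite !hn /iso/= => y1 y2.
by apply/eqP; rewrite -(intr_eq0 R); apply/eqP; lra.
Qed.

Lemma normal_cmove N s f : normal_subgroup N G -> N <> [set 1%g] ->
  PLc (ctr R s - 1 / 2) (ctr R s + 1 / 2) f -> N (cmove rho s f).
Proof.
move=> NG N1 fP; have [NN NsG _] := NG.
have [h Nh h1] : exists2 h, N h & h <> 1%g.
  apply: contrapT => H; apply: N1; rewrite eqEsubset; split=> [h Nh|h ->].
    by apply: contrapT => h1; apply: H; exists h.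
  exact: subgroup1.
have [k hk] := Glocal (NsG _ Nh).
have [[n hn]|[x hx]] := translation_or_free h.
  case: h1; apply: homeoR_eq => x.
  by rewrite hn (local_translation hk hn) mulr0z addr0.
have [K [j0 gW]] := good_of_free NG Nh hk hx.
exact: good_true_cmove NG (good_window_true NG gW) fP.
Qed.

End Simplicity.

(** * Symmetric maps, for which the exponents of the labels do not matter *)

Section Symmetric.
Variable R : realType.
Implicit Types (f g : homeoR R) (c p q x : R).

(** The two factors have disjoint supports and therefore commute, while reflection exchanges
    them. *)
Lemma mirror_symmetric c f : (forall x, f x = x \/ f (c - x) = c - x) ->
  mirror c (f * mirror c f)%g = (f * mirror c f)%g.
Proof.
move=> fc; rewrite mirrorM mirrorK; apply: commute_disjoint => x.
by case: (fc x) => [|fx]; [right|left; rewrite mirrorE fx subKr].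
Qed.

Lemma mirror_translate c f :
  mirror (2 * c) (f ^ affine 0 c)%g = (mirror 0 f ^ affine 0 c)%g.
Proof.
apply: homeoR_eq => x; rewrite mirrorE !conjg_affine mirrorE oppr0 !expr0z !mul1r.
by rewrite (_ : 2 * c - x - c = 0 - (x - c)); lra.
Qed.

End Symmetric.

Section SymmetricTiles.
Variables (R : realType) (rho : int -> letter).
Hypothesis rhoP : labelling rho.

Lemma cmove_symmetric s (f : homeoR R) j t : csupp s f -> mirror (2 * ctr R s) f = f ->
  centered s t -> cmove rho s f (iso j t) = iso j (f t).
Proof.
move=> fs fsym ts; have [jp|jn] := boolP (view rho j (idx s)).
  exact: cmove_iso.
rewrite -[t in LHS](subKr (2 * ctr R s)) -iso_nbr (cmove_iso rhoP)//.
- by rewrite iso_nbr -[in RHS]fsym.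
- by rewrite centered_mirror.
- by rewrite view_nbr (_ : 2 * idx s - idx s = idx s)//; lia.
Qed.

Lemma tileM_symmetric s (f : homeoI R) j t : mirror 1 f = f ->
  centered s t -> tileM rho s f (iso j t) = iso j (recenter s f t).
Proof.
move=> fsym ts; rewrite tileM_iso//; case: ifP => // _; congr iso.
by rewrite /recenter -[in RHS]fsym mirrorE (_ : 1 - (t - (ctr R s - 1 / 2)) = 2 * ctr R s - t - (ctr R s - 1 / 2)); lra.
Qed.

Lemma tileM_cmove s (f : homeoI R) : PLc 0 1 (f : homeoR R) ->
  exists2 g, PLc (ctr R s - 1 / 2) (ctr R s + 1 / 2) g & tileM rho s f = cmove rho s g.
Proof.
move=> fP.
have dc : dyadic (ctr R s - 1 / 2).
  case: s; rewrite /ctr; first by rewrite subrr; exact: (dyadic_int R 0).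
  by exists (-1), 1%N; rewrite expr1; lra.
exists ((f : homeoR R) ^ affine 0 (ctr R s - 1 / 2))%g.
  have := PLc_conj (affine_PL 0 dc) fP.
  by apply: PLc_sub; rewrite affineE expr0z; lra.
rewrite /cmove -conjgM (_ : (_ * _)%g = 1%g) ?conjg1.
  congr tileM; apply: homeoI_eq => x.
  by rewrite toIE//; exact: homeoI_supported.
by apply: homeoR_eq => x; rewrite homeoRME !affineE !expr0z homeoR1E; lra.
Qed.

(* The bumps of c0 at the endpoints of consecutive tiles fit together into a
   single homeomorphism supported well inside a tile of the other tiling. *)
Lemma tileM_nu1 s (c : homeoI R) : is_PL c -> supported 0 (1 / 4) c ->
  exists2 g, PLc (ctr R (~~ s) - 1 / 2) (ctr R (~~ s) + 1 / 2) g &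
    tileM rho s (c * iota_conj c)%g = cmove rho (~~ s) g.
Proof.
move=> cP cs.
(* The endpoints of the tiles of one tiling are the centres of the tiles of the other; around such a
   point [nu1] acts by [c] on the right and by its reflection on the left. *)
pose f := ((c : homeoR R) * mirror 0 c)%g.
pose g := (f ^ affine 0 (ctr R (~~ s)))%g.
have fs : supported (- (1 / 4)) (1 / 4) f.
  apply: (subgroupM (supported_subgroup _ _)).
    by apply: supported_sub cs; lra.
  by apply: supported_sub (supported_mirror (c := 0) cs); lra.
have dc : dyadic (ctr R (~~ s)).
  case: s {g}; rewrite /ctr; first exact: (dyadic_int R 0).
  by exists 1, 1%N; rewrite expr1 mulr1z.
have fP : PLc (- (1 / 2)) (1 / 2) f.
  split; last by exists (- (1 / 4)), (1 / 4); split => //; lra.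
  apply: (subgroupM (PL_subgroup R)) => //.
  exact: (mirror_PL (dyadic_int R 0)).
have gP : PLc (ctr R (~~ s) - 1 / 2) (ctr R (~~ s) + 1 / 2) g.
  have := PLc_conj (affine_PL 0 dc) fP.
  by apply: PLc_sub; rewrite affineE expr0z; lra.
exists g => //.
have nuE : (c * iota_conj c : homeoI R)%g = ((c : homeoR R) * mirror 1 c)%g :> homeoR R.
  exact: homeoR_eq.
have c14 u : u <= 0 \/ 1 / 4 <= u -> c u = u.
  have [|c0 c1] := @supported_end R 0 (1 / 4) c _ cs; first by lra.
  rewrite !le_eqVlt => -[/predU1P[->|u0]|/predU1P[<-|u1]]//; by apply: cs; apply/negP; lra.
have gsym : mirror (2 * ctr R (~~ s)) g = g.
  rewrite mirror_translate mirror_symmetric// => x.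
  by have [x0|x0] := leP x 0; [left|right]; apply: c14; left; lra.
have nusym : mirror 1 (c * iota_conj c : homeoI R)%g = (c * iota_conj c : homeoI R)%g.
  rewrite nuE mirror_symmetric// => x.
  by have [x0|x0] := leP x (1 / 2); [right|left]; apply: c14; right; lra.
apply: homeoR_eq => x; have [j [t [-> tI]]] := cellP x.
rewrite tileM_symmetric//; last exact: half_centered.
rewrite cmove_symmetric//; [|exact: PLc_supported gP|exact: half_centered].
have cI u : 0 <= u -> 0 <= c u.
  by move=> u0; rewrite -(homeoI_0 c) homeoR_le_mono.
congr iso; rewrite /recenter nuE /g conjg_affine oppr0 !expr0z !mul1r !homeoRME !mirrorE.
have c34 : c (1 / 4) = 1 / 4 by apply: c14; right.
case: s {g gP gsym dc}; rewrite /ctr; cbn [negb].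
  have e : c t <= 1 / 2.
    have [t4|t4] := leP t (1 / 4).
      by have : c t <= c (1 / 4); [rewrite homeoR_le_mono|rewrite c34; lra].
    by rewrite c14; [lra|right; lra].
  rewrite (_ : t - (_ - _) = t) ?subr0; last by lra.
  rewrite [c (1 - c t)]c14; last by right; lra.
  by rewrite [c (0 - c t)]c14; [lra|left; have := cI t; lra].
rewrite [c (t - (0 - _))]c14; last by right; lra.
rewrite [c (t - 1 / 2)]c14; last by left; lra.
by rewrite (_ : 1 - (t - _) = 0 - (t - 1 / 2)); lra.
Qed.

End SymmetricTiles.

(** * Powers of [nu1] push points away from the ends of the unit interval *)

Section Repulsion.
Variables (R : realType) (nu : homeoI R).
Hypothesis nu2 : forall t, 0 <= t < 1 / 16 -> nu t = 2 * t.
Hypothesis nu_ge : 1 / 16 <= nu (1 / 16).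
Hypothesis nu_sym : mirror 1 nu = nu.
Implicit Types (x t : R) (n : nat).

(** Each application doubles the point until it passes 1/16, and monotonicity with [nu_ge] keeps it
    above from then on. *)
Lemma repel_left n x : 2 ^- n / 16 <= x -> 1 / 16 <= (nu ^+ n)%g x.
Proof.
elim: n x => [|n IH] x xn; first by move: xn; rewrite expr0 invr1.
rewrite expgS homeoIME; apply: IH.
have n1 : 2 ^- n <= 1 :> R by rewrite invf_le1 ?exprn_gt0// exprn_ege1//; lra.
have n0 : 0 < 2 ^- n :> R by rewrite invr_gt0 exprn_gt0.
have [x16|x16] := leP (1 / 16) x.
  by apply: (@le_trans _ _ (nu (1 / 16))); [apply: le_trans nu_ge; lra|rewrite homeoR_le_mono].
move: xn; rewrite exprS invfM => xn; rewrite nu2; lra.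
Qed.

Lemma repel_right n x : x <= 1 - 2 ^- n / 16 -> (nu ^+ n)%g x <= 15 / 16.
Proof.
have sym t : nu t = 1 - nu (1 - t) by rewrite -[in LHS]nu_sym mirrorE.
have symn m t : (nu ^+ m)%g t = 1 - (nu ^+ m)%g (1 - t).
  elim: m t => [|m IH] t; first by rewrite subKr.
  by rewrite expgS !homeoIME IH {1}(sym t) subKr.
move=> xn; rewrite symn; have := @repel_left n (1 - x) ltac:(lra); lra.
Qed.

End Repulsion.

Theorem theorem1p3 (R : realType) (c0 nu2 nu3 : homeoI R)
    (rho : int -> letter) :
  thompsonF c0 ->
  supp c0 = `]0, 1 / 4[%classic ->
  (forall x : R, x \in `]0, 1 / 4[ -> c0 x > x) ->
  (forall t : R, t \in `]0, 1 / 16[ -> c0 t = 2 * t) ->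
  generated [set nu2; nu3] = thompsonF_on (1 / 16) (15 / 16) ->
  labelling rho ->
  quasi_periodic rho ->
  let nu1 := (c0 * iota_conj c0)%g in
  subgroup (G_rho rho nu1 nu2 nu3) /\
  fg_group (G_rho rho nu1 nu2 nu3) /\
  simple_group (G_rho rho nu1 nu2 nu3).
Proof.
move=> c0F c0supp c0gt c02 genF rhoP rhoQ nu1.
set G := G_rho rho nu1 nu2 nu3.
have cP : is_PL c0 by exact: thompsonF_PL.
have cs : supported 0 (1 / 4) c0.
  move=> x xI; apply: contrapT => cx; have : supp c0 x by [].
  by rewrite c0supp /= in_itv/=; move/negP: xI; lra.
have c2 t : 0 <= t < 1 / 16 -> c0 t = 2 * t.
  move=> /andP[]; rewrite le_eqVlt => /predU1P[<- _|t0 t1].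
    by rewrite homeoI_0 mulr0.
  by apply: c02; rewrite in_itv/= t0.
have bgt x : 0 < x < 1 / 4 -> x < c0 x by move=> xI; apply: c0gt; rewrite in_itv.
have w0 : (0 : R) < 1 / 4 by lra.
have into := @conj_into R c0 (1 / 4) cP w0 cs bgt.
have perfect := PLc_perfect cP w0 cs bgt (middle_perfect cP cs c2 genF).
have GG : subgroup G by exact: generated_subgroup.
have Ggen s (f : homeoI R) : f = nu1 \/ f = nu2 \/ f = nu3 -> G (tileM rho s f).
  move=> fnu; apply: sub_generated; rewrite /tileM /=.
  by case: s; case: fnu => [->|[->|->]]; tauto.
have Gpre s : subgroup [set f : homeoI R | G (tileM rho s f)].
  apply: mk_subgroup => [|f g /= Gf Gg].
    rewrite /= (_ : tileM rho s 1%g = 1%g); first exact: (subgroup1 GG).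
    by apply: (mulgI (tileM rho s 1%g)); rewrite -tileM_mul// !mulg1.
  by rewrite tileM_mul// tileM_inv//; exact: (subgroupMV GG).
have Gmid s (f : homeoI R) : thompsonF_on (1 / 16) (15 / 16) f -> G (tileM rho s f).
  rewrite -genF; move: f; apply: (generated_min (Gpre s)) => f fnu; apply: Ggen.
  by case: fnu => ->; tauto.
have nuE : (nu1 : homeoR R) = ((c0 : homeoR R) * mirror 1 c0)%g by exact: homeoR_eq.
have c14 u : u <= 0 \/ 1 / 4 <= u -> c0 u = u.
  have [|e0 e1] := @supported_end R 0 (1 / 4) c0 _ cs; first by lra.
  rewrite !le_eqVlt => -[/predU1P[->|u0]|/predU1P[<-|u1]]//; by apply: cs; apply/negP; lra.
have nusym : mirror 1 nu1 = nu1.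
  rewrite nuE mirror_symmetric// => x.
  by have [x0|x0] := leP x (1 / 2); [right|left]; apply: c14; right; lra.
have nulow t : 0 <= t <= 1 / 4 -> nu1 t = c0 t.
  move=> /andP[t0 t4]; rewrite nuE homeoRME mirrorE.
  have : c0 t <= c0 (1 / 4) by rewrite homeoR_le_mono.
  rewrite [c0 (1 / 4)]c14; last by right.
  by move=> ct; rewrite [c0 (1 - _)]c14 ?subKr//; right; lra.
have nudouble t : 0 <= t < 1 / 16 -> nu1 t = 2 * t.
  by move=> tI; rewrite nulow ?c2//; lra.
have nu16 : 1 / 16 <= nu1 (1 / 16).
  by rewrite nulow; [apply/ltW/bgt; lra|lra].
have nuP : is_PL nu1.
  rewrite nuE; apply: (subgroupM (PL_subgroup R)) => //.
  exact: (mirror_PL (dyadic_int R 1)).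
(* A power of [nu1] squeezes the compact support of f into [1/16, 15/16], where [nu2] and [nu3]
   generate everything. *)
have Gtile s (f : homeoI R) : PLc 0 1 (f : homeoR R) -> G (tileM rho s f).
  move=> [fP [p [q [p0 pq q1 fs]]]].
  have [n] := @exp2_lt R (Num.min p (1 - q)) ltac:(rewrite lt_min; lra).
  rewrite lt_min => /andP[np nq].
  have n0 : (0 : R) < 2 ^- n by rewrite invr_gt0 exprn_gt0.
  have hp := @repel_left R nu1 nudouble nu16 n p ltac:(lra).
  have hq := @repel_right R nu1 nudouble nu16 nusym n q ltac:(lra).
  have nunP : is_PL (nu1 ^+ n)%g.
    elim: (n) => [|m IH]; first exact: PL_id.
    by rewrite expgS; exact: PL_comp nuP IH.
  have : thompsonF_on (1 / 16) (15 / 16) (f ^ (nu1 ^+ n))%g.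
    split; first by apply: PL_thompsonF; exact: (subgroupJ (PL_subgroup R) fP nunP).
    apply/supp_sub; have := supported_conj (g := (nu1 ^+ n)%g) fs.
    exact: supported_sub.
  move=> /(Gmid s); rewrite -{2}(conjgK (nu1 ^+ n)%g f) => Gfn.
  apply: (subgroupJ (Gpre s)) => //; apply: (subgroupV (Gpre s)).
  elim: (n) => [|m IH]; first exact: (subgroup1 (Gpre s)).
  by rewrite expgS; apply: (subgroupM (Gpre s)) => //; apply: Ggen; left.
have Gmove s f : PLc (ctr R s - 1 / 2) (ctr R s + 1 / 2) f -> G (cmove rho s f).
  move=> fP; apply: Gtile.
  have dc : dyadic (1 / 2 - ctr R s).
    case: s {fP}; rewrite /ctr; first by rewrite subrr; exact: (dyadic_int R 0).
    by exists 1, 1%N; rewrite expr1 mulr1z; lra.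
  have := PLc_conj (affine_PL 0 dc) fP.
  rewrite !affineE expr0z => /(@PLc_sub _ _ _ 0 1) fP'.
  rewrite toIE; first by apply: fP'; lra.
  by apply: PLc_supported; apply: fP'; lra.
have Glocal h : G h -> exists k, local rho k h.
  move: h; apply: generated_min; first exact: local_subgroup.
  move=> h Sh; exists 1.
  by case: Sh => [[[[[|]|]|]|]|] ->;
    [exact: (local_tileM rhoP true)|exact: (local_tileM rhoP true)
    |exact: (local_tileM rhoP true)|exact: (local_tileM rhoP false)
    |exact: (local_tileM rhoP false)|exact: (local_tileM rhoP false)].
split=> //; split.
  by exists [set zeta rho nu1; zeta rho nu2; zeta rho nu3; chi rho nu1; chi rho nu2; chi rho nu3].
split=> //.
  (* By symmetry of [nu1], zeta(nu1) sends 1/32 to 1/16 whatever the label of the tile is. *)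
  move=> G1; have : [set 1%g] (zeta rho nu1) by rewrite -G1; apply: (Ggen true); left.
  move=> /(congr1 (fun h : homeoR R => h (iso (0, false) (1 / 32)))).
  rewrite (@tileM_symmetric _ _ rhoP true)//; last by rewrite /centered /ctr; lra.
  rewrite /recenter /ctr subrr subr0 nudouble; last by lra.
  by rewrite homeoR1E /iso/= mulr0z; lra.
move=> N NG; have [->|N1] := pselect (N = [set 1%g]); [by left|right].
have Ncmove s f := @normal_cmove R rho G rhoP rhoQ into perfect GG Gmove Glocal N s f NG N1.
have [NN NsG _] := NG.
rewrite eqEsubset; split => //; apply: generated_min => //.
(* Since [nu1] is not trivial near 0 and 1, its tiled action is obtained as a compactly supported
   one on the other tiling. *)
have Nnu1 s : N (tileM rho s nu1).
  by have [g gP ->] := tileM_nu1 rhoP s cP cs; exact: Ncmove.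
have Nmid s (f : homeoI R) : thompsonF_on (1 / 16) (15 / 16) f -> N (tileM rho s f).
  move=> fF; have fP : PLc 0 1 (f : homeoR R).
    by apply: thompsonF_on_PLc fF; lra.
  by have [g gP ->] := tileM_cmove rho s fP; exact: Ncmove.
have Fnu2 : thompsonF_on (1 / 16) (15 / 16) nu2.
  by rewrite -genF; apply: sub_generated; left.
have Fnu3 : thompsonF_on (1 / 16) (15 / 16) nu3.
  by rewrite -genF; apply: sub_generated; right.
by move=> h [[[[[|]|]|]|]|] ->;
  [exact: (Nnu1 true)|exact: (Nmid true)|exact: (Nmid true)
  |exact: (Nnu1 false)|exact: (Nmid false)|exact: (Nmid false)].
Qed.
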